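(* Let $S$ be an $\mathbb H^{N\times M}$-valued slice hyperholomorphic function in the open unit ball $\mathbb B$ of $\mathbb H$, such that the associated reproducing kernel Pontryagin space $\mathcal P(S)$ is finite dimensional. Then $S$ admits a representation of the form $$S(p)=B(p)^{-\star}\star S_0(p),\qquad p\in\mathbb B,$$ where $B$ is an $\mathbb H^{N\times N}$-valued Blaschke product and $S_0$ is an $\mathbb H^{N\times M}$-valued Schur multiplier.
   Context: $\mathbb H$ denotes the quaternions and $\mathbb B=\{p\in\mathbb H:|p|<1\}$. A matrix-valued function is slice hyperholomorphic in $\mathbb B$ if it is given there by a convergent power series $f(p)=\sum_{n\ge0}p^nf_n$ with matrix coefficients. The $\star$-product of $f(p)=\sum p^nf_n$ and $g(p)=\sum p^ng_n$ (of compatible sizes) is $(f\star g)(p)=\sum_n p^n\sum_{r=0}^nf_rg_{n-r}$, and $f^{-\star}$ is the inverse with respect to $\star$; thus $S=B^{-\star}\star S_0$ means $B\star S=S_0$. For an $\mathbb H^{N\times M}$-valued function $S$ put $K_S(p,q)=\sum_{n=0}^\infty p^n(I_N-S(p)S(q)^* )\overline q^{\,n}$. A Hermitian $\mathbb H^{N\times N}$-valued kernel $K$ on a set $\Omega$ has $\kappa$ negative squares if for all $m$, all $p_1,\dots,p_m\in\Omega$ and $c_1,\dots,c_m\in\mathbb H^N$, the Hermitian matrix with $(\ell,j)$ entry $c_\ell^*K(p_\ell,p_j)c_j$ has at most $\kappa$ strictly negative eigenvalues, and exactly $\kappa$ for some choice; it is positive definite if $\kappa=0$. When $K_S$ has a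 finite number of negative squares, $\mathcal P(S)$ denotes the right quaternionic reproducing kernel Pontryagin space of $\mathbb H^N$-valued functions with reproducing kernel $K_S$ (the hypothesis on $\mathcal P(S)$ includes that $K_S$ has finitely many negative squares). A Schur multiplier $S_0$ is a function slice hyperholomorphic in $\mathbb B$ such that $K_{S_0}$ is positive definite in $\mathbb B$. An $\mathbb H^{N\times N}$-valued (finite) Blaschke product is a function of the form $B(p)=D+\sum_{n\ge 0}p^{n+1}CA^nG$ with $A\in\mathbb H^{d\times d}$, $C\in\mathbb H^{N\times d}$, $G\in\mathbb H^{d\times N}$, $D\in\mathbb H^{N\times N}$, $d\ge0$, such that $\bigcap_{n\ge0}\ker CA^n=\{0\}$ and, for some positive definite $P\in\mathbb H^{d\times d}$ with $P-A^*PA=C^*C$, one has $K_B(p,q)=\big(\sum_{n\ge0}p^nCA^n\big)P^{-1}\big(\sum_{m\ge0}(A^* )^mC^*\overline q^{\,m}\big)$ for $p,q\in\mathbb B$ (for $d=0$, $B$ is a constant unitary matrix). *)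

(* Defs.v *)
From HB Require Import structures.
From mathcomp Require Import all_boot all_order all_algebra.
From mathcomp Require Import all_classical all_reals all_analysis.
From mathcomp Require Import ring lra.

Set Implicit Arguments.
Unset Strict Implicit.
Unset Printing Implicit Defensive.

Import Order.TTheory GRing.Theory Num.Theory.
Import numFieldNormedType.Exports.

Local Open Scope classical_set_scope.
Local Open Scope ring_scope.

Record quat (R : Type) := Quat { qre : R; qi : R; qj : R; qk : R }.

Section QuatRing.
Variable R : realType.
Implicit Types x y z : quat R.

Lemma quat_eq x y : qre x = qre y -> qi x = qi y -> qj x = qj y ->
  qk x = qk y -> x = y.
Proof. by case: x y => [a b c d] [a' b' c' d'] /= -> -> -> ->. Qed.

Definition quat_to_prod x := (qre x, qi x, qj x, qk x).
Definition quat_of_prod (u : R * R * R * R) :=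
  let: (a, b, c, d) := u in Quat a b c d.

Lemma quat_to_prodK : cancel quat_to_prod quat_of_prod.
Proof. by case. Qed.

HB.instance Definition _ := Choice.copy (quat R) (can_type quat_to_prodK).

Definition qadd x y :=
  Quat (qre x + qre y) (qi x + qi y) (qj x + qj y) (qk x + qk y).
Definition qopp x := Quat (- qre x) (- qi x) (- qj x) (- qk x).
Definition qreal (a : R) := Quat a 0 0 0.

Lemma qaddA : associative qadd.
Proof. by move=> x y z; apply: quat_eq; rewrite /= addrA. Qed.
Lemma qaddC : commutative qadd.
Proof. by move=> x y; apply: quat_eq; rewrite /= addrC. Qed.
Lemma qadd0 : left_id (qreal 0) qadd.
Proof. by move=> x; apply: quat_eq; rewrite /= add0r. Qed.
Lemma qaddN : left_inverse (qreal 0) qopp qadd.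
Proof. by move=> x; apply: quat_eq; rewrite /= addNr. Qed.

HB.instance Definition _ :=
  GRing.isZmodule.Build (quat R) qaddA qaddC qadd0 qaddN.

Definition qmul x y := Quat
  (qre x * qre y - qi x * qi y - qj x * qj y - qk x * qk y)
  (qre x * qi y + qi x * qre y + qj x * qk y - qk x * qj y)
  (qre x * qj y - qi x * qk y + qj x * qre y + qk x * qi y)
  (qre x * qk y + qi x * qj y - qj x * qi y + qk x * qre y).

Lemma qmulA : associative qmul.
Proof. by move=> x y z; apply: quat_eq => /=; ring. Qed.
Lemma qmul1 : left_id (qreal 1) qmul.
Proof. by move=> x; apply: quat_eq => /=; ring. Qed.
Lemma qmul1r : right_id (qreal 1) qmul.
Proof. by move=> x; apply: quat_eq => /=; ring. Qed.
Lemma qmulDl : left_distributive qmul qadd.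
Proof. by move=> x y z; apply: quat_eq => /=; ring. Qed.
Lemma qmulDr : right_distributive qmul qadd.
Proof. by move=> x y z; apply: quat_eq => /=; ring. Qed.
Lemma qone_neq0 : qreal 1 != 0 :> quat R.
Proof. by apply/eqP => -[] /eqP; rewrite oner_eq0. Qed.

HB.instance Definition _ := GRing.Zmodule_isNzRing.Build (quat R)
  qmulA qmul1 qmul1r qmulDl qmulDr qone_neq0.

Definition qscale (a : R) x := Quat (a * qre x) (a * qi x) (a * qj x) (a * qk x).

Lemma qscaleA a b x : qscale a (qscale b x) = qscale (a * b) x.
Proof. by apply: quat_eq; rewrite /= mulrA. Qed.
Lemma qscale1 : left_id 1 qscale.
Proof. by move=> x; apply: quat_eq; rewrite /= mul1r. Qed.
Lemma qscaleDr : right_distributive qscale +%R.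
Proof. by move=> a x y; apply: quat_eq; rewrite /= mulrDr. Qed.
Lemma qscaleDl x : {morph qscale^~ x : a b / a + b}.
Proof. by move=> a b; apply: quat_eq; rewrite /= mulrDl. Qed.

HB.instance Definition _ := GRing.Zmodule_isLmodule.Build R (quat R)
  qscaleA qscale1 qscaleDr qscaleDl.

Definition qconj x := Quat (qre x) (- qi x) (- qj x) (- qk x).

Definition qnorm x := Num.sqrt (qre x ^+ 2 + qi x ^+ 2 + qj x ^+ 2 + qk x ^+ 2).

Lemma qsqr_ge0 x : 0 <= qre x ^+ 2 + qi x ^+ 2 + qj x ^+ 2 + qk x ^+ 2.
Proof. by rewrite !addr_ge0 ?sqr_ge0. Qed.

Lemma qnormD x y : qnorm (x + y) <= qnorm x + qnorm y.
Proof.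
rewrite -(@ler_pXn2r _ 2) ?nnegrE ?addr_ge0 ?sqrtr_ge0 //.
rewrite sqrrD !sqr_sqrtr ?qsqr_ge0 //.
set s := (X in X <= _); set sx := (X in _ <= X + _ + _).
set sy := (X in _ <= _ + X).
pose t := qre x * qre y + qi x * qi y + qj x * qj y + qk x * qk y.
have -> : s = sx + t *+ 2 + sy by rewrite /s /sx /sy /t /=; ring.
rewrite lerD2r lerD2l lerMn2r /=.
rewrite -sqrtrM ?qsqr_ge0 // (le_trans (ler_norm _)) // -sqrtr_sqr.
rewrite ler_sqrt ?mulr_ge0 ?qsqr_ge0 // -subr_ge0.
rewrite [X in 0 <= X](_ : _ =
  (qre x * qi y - qi x * qre y) ^+ 2 + (qre x * qj y - qj x * qre y) ^+ 2
  + (qre x * qk y - qk x * qre y) ^+ 2 + (qi x * qj y - qj x * qi y) ^+ 2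
  + (qi x * qk y - qk x * qi y) ^+ 2 + (qj x * qk y - qk x * qj y) ^+ 2).
  by rewrite !addr_ge0 ?sqr_ge0.
by rewrite /sx /sy /t; ring.
Qed.

Lemma qnormZ a x : qnorm (a *: x) = `|a| * qnorm x.
Proof.
rewrite -sqrtr_sqr -sqrtrM ?sqr_ge0 //; congr Num.sqrt.
by rewrite /=; ring.
Qed.

Lemma qnorm0_eq0 x : qnorm x = 0 -> x = 0.
Proof.
move/eqP; rewrite sqrtr_eq0 => xle0.
have := qsqr_ge0 x; case: x xle0 => a b c d /= h1 h2.
have: a ^+ 2 + b ^+ 2 + c ^+ 2 + d ^+ 2 == 0 by rewrite eq_le h1 h2.
rewrite !paddr_eq0 ?addr_ge0 ?sqr_ge0 // !sqrf_eq0.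
by move=> /andP[/andP[/andP[/eqP-> /eqP->] /eqP->] /eqP->].
Qed.

(* The norm `|x| is the Euclidean one, and the topology is the induced one. *)
HB.instance Definition _ :=
  Lmodule_isNormed.Build R (quat R) qnormD qnormZ qnorm0_eq0.

End QuatRing.

Definition adjmx (R : realType) (m n : nat) (A : 'M[quat R]_(m, n)) :
    'M[quat R]_(n, m) := map_mx (@qconj R) A^T.

Notation "A ^h" := (adjmx A) (at level 2, format "A ^h") : ring_scope.

(* Matrices over a noncommutative ring only come with the left scaling
   a *: A; right scaling is right multiplication by a scalar matrix. *)
Definition rscale (R : realType) (m n : nat) (A : 'M[quat R]_(m, n))
  (a : quat R) : 'M[quat R]_(m, n) := A *m a%:M.

Definition qball (R : realType) : Type := {p : quat R | `|p| < 1}.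

Definition has_power_series (R : realType) (N M : nat)
    (f : qball R -> 'M[quat R]_(N, M)) (a : nat -> 'M[quat R]_(N, M)) :=
  forall p : qball R, series (fun n => (val p) ^+ n *: a n) @ \oo --> f p.

Definition slice_hyperholomorphic (R : realType) (N M : nat)
    (f : qball R -> 'M[quat R]_(N, M)) :=
  exists a, has_power_series f a.

(* [star_product f g h] says that f and g are slice hyperholomorphic and that
   their star product is h. *)
Definition star_product (R : realType) (N M L : nat)
    (f : qball R -> 'M[quat R]_(N, M)) (g : qball R -> 'M[quat R]_(M, L))
    (h : qball R -> 'M[quat R]_(N, L)) :=
  exists a b, [/\ has_power_series f a, has_power_series g b &
    has_power_series h (fun n => \sum_(r < n.+1) a r *m b (n - r)%N)].

(* The series converges for all p, q in the ball, so that lim is its sum. *)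
Definition schur_kernel (R : realType) (N M : nat)
    (S : qball R -> 'M[quat R]_(N, M)) (p q : qball R) : 'M[quat R]_N :=
  lim (series (fun n =>
    rscale ((val p) ^+ n *: (1%:M - S p *m (S q)^h)) (qconj (val q) ^+ n))
    @ \oo).

Definition hermitian_mx (R : realType) (m : nat) (A : 'M[quat R]_m) :=
  A^h = A.

(* The columns of U are right linearly independent eigenvectors of A, for the
   strictly negative eigenvalues lam (all right eigenvalues of a Hermitian
   quaternionic matrix are real). *)
Definition negative_eigenvectors (R : realType) (m k : nat) (A : 'M[quat R]_m)
    (U : 'M[quat R]_(m, k)) (lam : 'I_k -> R) :=
  [/\ forall a : 'cV[quat R]_k, U *m a = 0 -> a = 0,
      forall i, col i U != 0 /\ A *m col i U = rscale (col i U) (qreal (lam i)) &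
      forall i, lam i < 0].

(* Number of strictly negative eigenvalues of a Hermitian matrix, counted with
   multiplicity: the largest number of independent eigenvectors. *)
Definition num_negative_eigenvalues (R : realType) (m : nat)
    (A : 'M[quat R]_m) : nat :=
  \max_(k < m.+1 | `[< exists (U : 'M[quat R]_(m, k)) (lam : 'I_k -> R),
                       negative_eigenvectors A U lam >]) k.

Definition gram_mx (R : realType) (Omega : Type) (N m : nat)
    (K : Omega -> Omega -> 'M[quat R]_N) (p : 'I_m -> Omega)
    (c : 'I_m -> 'cV[quat R]_N) : 'M[quat R]_m :=
  \matrix_(l, j) ((c l)^h *m K (p l) (p j) *m c j) 0 0.

Definition hermitian_kernel (R : realType) (Omega : Type) (N : nat)
    (K : Omega -> Omega -> 'M[quat R]_N) :=
  forall p q, K q p = (K p q)^h.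

Definition has_negative_squares (R : realType) (Omega : Type) (N : nat)
    (K : Omega -> Omega -> 'M[quat R]_N) (kappa : nat) :=
  [/\ hermitian_kernel K,
      forall (m : nat) (p : 'I_m -> Omega) (c : 'I_m -> 'cV[quat R]_N),
        (num_negative_eigenvalues (gram_mx K p c) <= kappa)%N &
      exists (m : nat) (p : 'I_m -> Omega) (c : 'I_m -> 'cV[quat R]_N),
        num_negative_eigenvalues (gram_mx K p c) = kappa].

Definition positive_kernel (R : realType) (Omega : Type) (N : nat)
    (K : Omega -> Omega -> 'M[quat R]_N) := has_negative_squares K 0.

Definition fscale (R : realType) (Omega : Type) (N : nat)
    (f : Omega -> 'cV[quat R]_N) (a : quat R) : Omega -> 'cV[quat R]_N :=
  fun p => rscale (f p) a.

Definition right_subspace (R : realType) (Omega : Type) (N : nat)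
    (V : set (Omega -> 'cV[quat R]_N)) :=
  [/\ V 0, forall f g, V f -> V g -> V (f + g) &
      forall f a, V f -> V (fscale f a)].

Definition right_finite_dim (R : realType) (Omega : Type) (N : nat)
    (V : set (Omega -> 'cV[quat R]_N)) :=
  exists (n : nat) (e : 'I_n -> Omega -> 'cV[quat R]_N),
    (forall i, V (e i)) /\
    forall f, V f -> exists a : 'I_n -> quat R, f = \sum_(i < n) fscale (e i) (a i).

(* A Hermitian form on V, right linear in the first variable. *)
Definition hermitian_form (R : realType) (Omega : Type) (N : nat)
    (V : set (Omega -> 'cV[quat R]_N))
    (ip : (Omega -> 'cV[quat R]_N) -> (Omega -> 'cV[quat R]_N) -> quat R) :=
  [/\ forall f g h, V f -> V g -> V h -> ip (f + g) h = ip f h + ip g h,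
      forall f g a b, V f -> V g ->
        ip (fscale f a) (fscale g b) = qconj b * ip f g * a &
      forall f g, V f -> V g -> ip g f = qconj (ip f g)].

(* For a Hermitian form, ip f f is real; it is the squared norm of f. *)
Definition hilbert_space (R : realType) (Omega : Type) (N : nat)
    (V : set (Omega -> 'cV[quat R]_N))
    (ip : (Omega -> 'cV[quat R]_N) -> (Omega -> 'cV[quat R]_N) -> quat R) :=
  [/\ right_subspace V, hermitian_form V ip,
      forall f, V f -> f <> 0 -> 0 < qre (ip f f) &
      forall u : nat -> Omega -> 'cV[quat R]_N, (forall n, V (u n)) ->
        (forall e : R, 0 < e -> exists n0, forall n m, (n0 <= n)%N -> (n0 <= m)%N ->
           qre (ip (u n - u m) (u n - u m)) < e) ->
        exists2 f, V f & (fun n => qre (ip (u n - f) (u n - f))) @ \oo --> (0 : R)].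

(* A Hermitian form space that is the orthogonal sum of a Hilbert space and of
   a finite dimensional anti-Hilbert space (the sum is automatically direct). *)
Definition pontryagin_space (R : realType) (Omega : Type) (N : nat)
    (V : set (Omega -> 'cV[quat R]_N))
    (ip : (Omega -> 'cV[quat R]_N) -> (Omega -> 'cV[quat R]_N) -> quat R) :=
  [/\ right_subspace V, hermitian_form V ip &
      exists Vp Vm : set (Omega -> 'cV[quat R]_N),
        [/\ hilbert_space Vp ip,
            hilbert_space Vm (fun f g => - ip f g),
            right_finite_dim Vm,
            forall f g, Vp f -> Vm g -> ip f g = 0 &
            V = [set f | exists g h, [/\ Vp g, Vm h & f = g + h]]]].

Definition rk_pontryagin_space (R : realType) (Omega : Type) (N : nat)
    (K : Omega -> Omega -> 'M[quat R]_N) (V : set (Omega -> 'cV[quat R]_N))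
    (ip : (Omega -> 'cV[quat R]_N) -> (Omega -> 'cV[quat R]_N) -> quat R) :=
  [/\ pontryagin_space V ip,
      forall q (c : 'cV[quat R]_N), V (fun p => K p q *m c) &
      forall q (c : 'cV[quat R]_N) f, V f ->
        ip f (fun p => K p q *m c) = (c^h *m f q) 0 0].

Definition schur_multiplier (R : realType) (N M : nat)
    (S : qball R -> 'M[quat R]_(N, M)) :=
  slice_hyperholomorphic S /\ positive_kernel (schur_kernel S).

Definition positive_definite_mx (R : realType) (d : nat) (P : 'M[quat R]_d) :=
  hermitian_mx P /\ forall v : 'cV[quat R]_d, v != 0 -> 0 < qre ((v^h *m P *m v) 0 0).

(* The spectral radius of A is less than 1 under the conditions below, hence
   the two limits are sums of convergent series; Q is the inverse of P. *)
Definition blaschke_product (R : realType) (N : nat)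
    (B : qball R -> 'M[quat R]_N) :=
  exists (d : nat) (A : 'M[quat R]_d) (C : 'M[quat R]_(N, d))
    (G : 'M[quat R]_(d, N)) (D : 'M[quat R]_N) (P Q : 'M[quat R]_d),
    [/\ forall p : qball R,
          D + series (fun n => (val p) ^+ n.+1 *: (C *m A ^+ n *m G)) k
            @[k --> \oo] --> B p,
        forall v : 'cV[quat R]_d, (forall n, C *m A ^+ n *m v = 0) -> v = 0,
        positive_definite_mx P /\ (P *m Q = 1%:M /\ Q *m P = 1%:M),
        P - A^h *m P *m A = C^h *m C &
        forall p q : qball R, schur_kernel B p q =
          lim (series (fun n => (val p) ^+ n *: (C *m A ^+ n)) @ \oo) *m Q *m
          lim (series (fun m =>
                 rscale (A^h ^+ m *m C^h) (qconj (val q) ^+ m)) @ \oo)].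

(* Main.v *)
(** Since S is given by a power series in the whole ball, K_S is in fact positive,
    so that B = 1 and S_0 = S.  In real coordinates, let T be the block Toeplitz
    operator of the Taylor coefficients of S.  On finitely supported sequences the
    form Q of I - T T^* satisfies Q(Xu, Xv) = Q(u, v) - <b u, b v>, with X the shift
    and b u the new entry of T^* X u, and finite dimensionality of P(S) says that Q
    has finite rank t.  The radical of Q is X-invariant and contained in the kernel
    of b, so by Cayley-Hamilton |Q(u, u)| is bounded by a constant times the sum of
    |b X^n u|^2 over n < t.  If Q(u, u) were negative, - Q(X^n u, X^n u) would then
    grow exponentially, whereas the Taylor coefficients of S grow
    subexponentially. *)
Require Import Defs.
From mathcomp Require Import all_boot all_order all_algebra.
From mathcomp Require Import all_classical all_reals all_analysis.
From mathcomp Require Import ring lra.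

Set Implicit Arguments.
Unset Strict Implicit.
Unset Printing Implicit Defensive.

Import Order.TTheory GRing.Theory Num.Theory.
Import numFieldNormedType.Exports.

Local Open Scope classical_set_scope.
Local Open Scope ring_scope.

(** The obstacle is that T is not known to be bounded. On finitely supported sequences, encoded as
    vectors of polynomials, T^* is given by finite sums and keeps supports finite, so the argument
    up to the growth estimate is pure algebra; real scalars make these vectors a module over a
    commutative polynomial ring. Finite rank is extracted from real points only. There scalars
    commute with matrices, so the kernel satisfies (1 - xy) K_S(x, y) = I - S(x) S(y)^*, and the
    values on (0, 1) already determine Taylor coefficients. The way back to the whole ball is the
    eigenvector relation of T^*: it sends the sequence conj(p)^k d to S(p)^* conj(p)^k d. The
    inequality |T^* U| <= |U|, passed to the limit on sums of such sequences, is the positivity of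
    K_S. *)

Definition dotv (R : pzRingType) (n : nat) (u v : 'rV[R]_n) : R :=
  (u *m v^T) 0 0.

(** * Real linear algebra and growth estimates *)

Section DotProduct.
Variables (R : realFieldType) (n : nat).
Implicit Types u v w : 'rV[R]_n.

Lemma dotvE u v : dotv u v = \sum_i u 0 i * v 0 i.
Proof. by rewrite /dotv mxE; apply: eq_bigr => i _; rewrite mxE. Qed.

Lemma dotv0l w : dotv 0 w = 0.
Proof. by rewrite /dotv mul0mx mxE. Qed.

Lemma dotv_ge0 u : 0 <= dotv u u.
Proof. by rewrite dotvE sumr_ge0 // => i _; rewrite -expr2 sqr_ge0. Qed.

Lemma dotv_eq0 u : dotv u u = 0 -> u = 0.
Proof.
rewrite dotvE => /eqP; rewrite psumr_eq0 => [/allP u0|i _]; last first.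
  by rewrite -expr2 sqr_ge0.
apply/rowP => i; rewrite mxE; have := u0 i (mem_index_enum i).
by rewrite mulf_eq0 orbb => /eqP.
Qed.

End DotProduct.

(** Ranks of finite subfamilies are bounded by k, and a subfamily of maximal rank cannot gain a row.
    The spanning rows are values of f itself, so they come with preimages in T. *)
Lemma finite_row_span (R : fieldType) (T : Type) (k : nat) (f : T -> 'rV[R]_k) :
  exists (r : nat) (e : 'I_r -> T), forall u, (f u <= \matrix_i f (e i))%MS.
Proof.
pose P n := `[< exists (r : nat) (e : 'I_r -> T),
  \rank (\matrix_i f (e i)) = n >].
have exP : exists n, P n.
  exists (\rank (\matrix_(i < 0) (0 : 'rV[R]_k))); apply/asboolP.
  have e : 'I_0 -> T by case.
  by exists 0%N, e; congr (\rank _); apply/matrixP; case.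
have ubP n : P n -> (n <= k)%N by move=> /asboolP[r [e <-]]; exact: rank_leq_col.
case: (ex_maxnP exP ubP) => n /asboolP[r [e re]] nmax.
exists r, e => u; set A := \matrix_i f (e i).
pose e' (i : 'I_(1 + r)) := if fintype.split i is inr j then e j else u.
have eA : \matrix_i f (e' i) = col_mx (f u) A.
  apply/row_matrixP => i; rewrite rowK /e'; case: fintype.splitP => j ij.
    by rewrite (_ : i = lshift r j) ?rowKu ?row_id //; exact: val_inj.
  by rewrite (_ : i = rshift 1 j) ?rowKd ?rowK //; exact: val_inj.
have le : (\rank (col_mx (f u) A) <= \rank A)%N.
  by rewrite re nmax //; apply/asboolP; exists _, e'; rewrite eA.
rewrite -(addsmxE (f u) A) in le.
have := mxrank_leqif_sup (addsmxSr (f u) A).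
case=> le1 eq1; have : \rank A == \rank (f u + A)%MS by rewrite eqn_leq le1 le.
by rewrite eq1; apply: submx_trans; exact: addsmxSl.
Qed.

(* A module over {poly R} is a real vector space with an endomorphism. *)
Definition real_linear (R : nzRingType) (V : lmodType {poly R}) (W : lmodType R)
    (f : V -> W) :=
  forall c u v, f (c%:P *: u + v) = c *: f u + f v.

Section RealLinear.
Variables (R : fieldType) (V : lmodType {poly R}) (W : lmodType R).
Variables (f : V -> W) (fL : real_linear f).

Lemma rlinD u v : f (u + v) = f u + f v.
Proof. by rewrite -[u]scale1r -polyC1 fL !scale1r. Qed.

Lemma rlin0 : f 0 = 0.
Proof. by apply: (addrI (f 0)); rewrite -rlinD !addr0. Qed.

Lemma rlinZ c u : f (c%:P *: u) = c *: f u.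
Proof. by rewrite -[_ *: u]addr0 fL rlin0 addr0. Qed.

Lemma rlinB u v : f (u - v) = f u - f v.
Proof. by rewrite -scaleN1r -polyC1 -polyCN rlinD rlinZ scaleN1r. Qed.

Lemma rlin_sum (I : Type) (r : seq I) (P : pred I) (F : I -> V) :
  f (\sum_(i <- r | P i) F i) = \sum_(i <- r | P i) f (F i).
Proof. exact: (big_morph f rlinD rlin0). Qed.

Lemma rlin_poly (p : {poly R}) m u : (size p <= m)%N ->
  f (p *: u) = \sum_(i < m) p`_i *: f ('X^i *: u).
Proof.
move=> sp; have {1}-> : p = \sum_(i < m) (p`_i)%:P * 'X^i.
  rewrite -[LHS]coefK poly_def (big_ord_widen_cond m predT (fun i => p`_i *: 'X^i)) //.
  rewrite big_mkcond /=; apply: eq_bigr => i _; rewrite mul_polyC.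
  by case: ltnP => // h; rewrite nth_default ?scale0r.
rewrite scaler_suml rlin_sum; apply: eq_bigr => i _.
by rewrite -scalerA rlinZ.
Qed.

End RealLinear.

(** The t + 1 vectors f(X^i u), i <= t, live in dimension t, hence are dependent; p collects the
    coefficients of a relation. *)
Lemma exists_annihilator (R : fieldType) (V : lmodType {poly R}) (t : nat)
    (f : V -> 'rV[R]_t) (fL : real_linear f) (u : V) :
  exists p : {poly R}, [/\ p != 0, (size p <= t.+1)%N & f (p *: u) = 0].
Proof.
pose A : 'M[R]_(t.+1, t) := \matrix_i f ('X^i *: u).
have /rowV0Pn[v /sub_kermxP vA v0] : kermx A != 0.
  rewrite -mxrank_eq0 mxrank_ker -lt0n subn_gt0 ltnS; exact: rank_leq_col.
exists (rVpoly v); split.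
- by apply: contra v0 => /eqP h; rewrite -[v]rVpolyK h raddf0.
- exact: size_poly.
rewrite (rlin_poly fL _ (size_poly _ _)) -[RHS]vA mulmx_sum_row.
by apply: eq_bigr => i _; rewrite rowK coef_rVpoly_ord.
Qed.

Lemma quadratic_form_bound (R : realFieldType) (k : nat) (H : 'M[R]_k) :
  exists2 C, 0 < C & forall u : 'rV_k, `|(u *m H *m u^T) 0 0| <= C * dotv u u.
Proof.
(* The summand 1 keeps the constant positive when H = 0. *)
exists (1 + \sum_i \sum_j `|H j i|).
  by rewrite ltr_pwDl // !sumr_ge0 // => i _; rewrite sumr_ge0.
move=> u; have le_u i : u 0 i ^+ 2 <= dotv u u.
  rewrite dotvE (bigD1 i) //= -expr2 lerDl sumr_ge0 // => j _.
  by rewrite -expr2 sqr_ge0.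
apply: (@le_trans _ _ ((\sum_i \sum_j `|H j i|) * dotv u u)); last first.
  by rewrite ler_wpM2r ?dotv_ge0 // lerDr.
rewrite mxE (le_trans (ler_norm_sum _ _ _)) // mulr_suml ler_sum // => i _.
rewrite mxE !mulr_suml (le_trans (ler_norm_sum _ _ _)) // ler_sum // => j _.
rewrite !mxE mulrAC normrM [X in X <= _]mulrC ler_wpM2l // ler_norml.
have := le_u i; have := le_u j; have := sqr_ge0 (u 0 i + u 0 j).
have := sqr_ge0 (u 0 i - u 0 j); rewrite !expr2 => *; apply/andP; split; nra.
Qed.

Lemma bernoulli_geD1 (R : realFieldType) (h : R) n : 0 <= h ->
  1 + n%:R * h <= (1 + h) ^+ n.
Proof.
move=> h0; elim: n => [|n IH]; first by rewrite mul0r addr0 expr0.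
rewrite exprS -natr1; apply: le_trans (ler_wpM2l _ IH); last lra.
have : 0 <= n%:R :> R by []. nra.
Qed.

Lemma bernoulli_geB1 (R : realFieldType) (h : R) n : 0 <= h -> h <= 1 ->
  1 - n%:R * h <= (1 - h) ^+ n.
Proof.
move=> h0 h1; elim: n => [|n IH]; first by rewrite mul0r subr0 expr0.
rewrite exprS -natr1; apply: le_trans (ler_wpM2l _ IH); last lra.
have : 0 <= n%:R :> R by []. nra.
Qed.

(** Adding the increments over t steps gives q(n + t) >= (1 + delta) q(n). A positive q(0) would
    thus force exponential growth along multiples of t, also for the sums of d, against the last
    hypothesis with r close to 1. *)
Lemma growth_le0 (R : realType) (q d : nat -> R) (t : nat) (delta : R) :
  (forall n, q n.+1 = q n + d n) -> (forall n, 0 <= d n) -> 0 < delta ->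
  (forall n, delta * q n <= \sum_(j < t) d (n + j)%N) ->
  (forall r, 0 < r -> r < 1 -> exists C, forall n, d n * r ^+ n <= C) ->
  q 0%N <= 0.
Proof.
move=> qS d0 dl0 qd dr; rewrite leNgt; apply/negP => q0.
have qt n : q (n + t)%N = q n + \sum_(j < t) d (n + j)%N.
  elim: t {qd} => [|t IH]; first by rewrite addn0 big_ord0 addr0.
  by rewrite addnS qS IH big_ord_recr /= addrA.
have qge n : (1 + delta) ^+ n * q 0%N <= q (n * t)%N.
  elim: n => [|n IH]; first by rewrite expr0 mul1r.
  rewrite mulSn addnC qt exprS -mulrA.
  have := qd (n * t)%N; nra.
(* With r = 1 - eps, Bernoulli's inequality gives (1 + delta) r^t >= 1 + delta / 2. Using t + 1 in
   the denominator covers t = 0. *)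
pose eps := delta / (2 * (1 + delta) * t.+1%:R).
have t0 : 0 < t.+1%:R :> R by rewrite ltr0n.
have e0 : 0 < eps by rewrite divr_gt0 // !mulr_gt0 //; lra.
have epsE : eps * (2 * (1 + delta) * t.+1%:R) = delta.
  by rewrite divfK // lt0r_neq0 // !mulr_gt0 //; lra.
have t1 : 1 <= t.+1%:R :> R by rewrite ler1n.
have e1 : eps < 1.
  rewrite ltNge; apply/negP => h.
  suff : 2 * (1 + delta) <= eps * (2 * (1 + delta) * t.+1%:R) by lra.
  have -> : eps * (2 * (1 + delta) * t.+1%:R) = 2 * (1 + delta) * (eps * t.+1%:R).
    by ring.
  rewrite ler_peMr //; first lra.
  by rewrite -[leLHS]mulr1 ler_pM.
pose r := 1 - eps; have r0 : 0 < r by rewrite /r; lra.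
have r1 : r < 1 by rewrite /r; lra.
have [K KP] := dr r r0 r1.
have rt : 1 + delta / 2 <= (1 + delta) * r ^+ t.
  have te : t%:R * eps * (2 * (1 + delta)) <= delta.
    rewrite -[X in _ <= X]epsE -natr1; nra.
  have := bernoulli_geB1 t (ltW e0) (ltW e1).
  rewrite -/r => h; have : (1 + delta) * (1 - t%:R * eps) <= (1 + delta) * r ^+ t.
    by rewrite ler_wpM2l //; lra.
  lra.
have bound n : delta * q 0%N * r ^+ t * (1 + n%:R * (delta / 2)) <= t%:R * K.
  have d20 : 0 <= delta / 2 by lra.
  have h1 : 1 + n%:R * (delta / 2) <= ((1 + delta) * r ^+ t) ^+ n.
    apply: le_trans (bernoulli_geD1 n d20) _.
    by apply: lerXn2r; rewrite ?nnegrE //; lra.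
  apply: (@le_trans _ _ (delta * q 0%N * r ^+ t * ((1 + delta) * r ^+ t) ^+ n)).
    by rewrite ler_wpM2l // !mulr_ge0 ?exprn_ge0 // ltW.
  apply: (@le_trans _ _ ((\sum_(j < t) d (n * t + j)%N) * r ^+ (n * t + t)%N)).
    apply: le_trans (ler_wpM2r _ (qd (n * t)%N)); last by rewrite exprn_ge0 // ltW.
    rewrite exprMn -exprM exprD [(t * n)%N]mulnC.
    have -> : delta * q 0%N * r ^+ t * ((1 + delta) ^+ n * r ^+ (n * t)) =
      delta * ((1 + delta) ^+ n * q 0%N) * (r ^+ (n * t) * r ^+ t) by ring.
    by rewrite ler_wpM2r ?mulr_ge0 ?exprn_ge0 ?(ltW r0) // ler_wpM2l // ltW.
  rewrite mulr_suml [X in _ <= X]mulrC.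
  have -> : K * t%:R = \sum_(j < t) K by rewrite sumr_const card_ord mulr_natr.
  apply: ler_sum => j _; apply: le_trans (KP (n * t + j)%N).
  by rewrite ler_wpM2l // ler_wiXn2l ?(ltW r0) ?(ltW r1) // leq_add2l ltnW.
(* c is the slope in n of the left side of [bound]; an n beyond t K / c contradicts it. *)
pose c := delta * q 0%N * r ^+ t * (delta / 2).
have c0 : 0 < c by rewrite !mulr_gt0 ?exprn_gt0 //; lra.
have b0 := bound (Num.bound `|t%:R * K / c|).
have : t%:R * K < (Num.bound `|t%:R * K / c|)%:R * c.
  by rewrite -ltr_pdivrMr // (le_lt_trans (ler_norm _)) // archi_boundP.
rewrite ltNge => /negP; apply; apply: le_trans b0.
set m := (Num.bound _)%:R; rewrite /c.
have : 0 < delta * q 0%N * r ^+ t by rewrite !mulr_gt0 ?exprn_gt0.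
move: (delta * q 0%N * r ^+ t) => x x0.
by rewrite mulrDr mulr1 mulrCA lerDr ltW.
Qed.

(** * Nonnegativity of a finite-rank form that satisfies the shift identity *)

Section ShiftForm.
Variables (R : realType) (V : lmodType {poly R}) (M t : nat).
Variables (Q : V -> V -> R) (b : V -> 'rV[R]_M) (psi : V -> 'rV[R]_t).
Hypothesis QL : forall v, real_linear (W := R^o) (Q^~ v).
Hypothesis QC : forall u v, Q u v = Q v u.
Hypothesis bL : real_linear b.
Hypothesis psiL : real_linear psi.
Hypothesis QX : forall u v, Q ('X *: u) ('X *: v) = Q u v - dotv (b u) (b v).
(** Finite rank of Q: t real conditions put u in the radical. *)
Hypothesis psi_ker : forall u, psi u = 0 -> forall v, Q u v = 0.
Hypothesis QX_const : forall v, exists a v', v = a + 'X *: v' /\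
  forall w, b w = 0 -> Q ('X *: w) a = 0.
Hypothesis QXn0 : forall v, exists n, forall w,
  (forall k, b ('X^k *: w) = 0) -> Q ('X^n *: w) v = 0.
Hypothesis b_subexp : forall u (r : R), 0 < r -> r < 1 ->
  exists C, forall n, dotv (b ('X^n *: u)) (b ('X^n *: u)) * r ^+ n <= C.

Let rad u := forall v, Q u v = 0.

Let QlD u v w : Q (u + v) w = Q u w + Q v w. Proof. exact: (rlinD (QL w)). Qed.
Let QlB u v w : Q (u - v) w = Q u w - Q v w. Proof. exact: (rlinB (QL w)). Qed.

Let QlZ c u w : Q (c%:P *: u) w = c * Q u w. Proof. exact: (rlinZ (QL w)). Qed.
Let Ql0 w : Q 0 w = 0. Proof. exact: (rlin0 (QL w)). Qed.

Let radD u v : rad u -> rad v -> rad (u + v).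
Proof. by move=> hu hv w; rewrite QlD hu hv addr0. Qed.

(* Otherwise Q would be negative definite on the multiples of 'X *: w. *)
Let rad_b w : rad w -> b w = 0.
Proof.
move=> rw; apply/eqP/negP => /negP bw0.
have [p [p0 _ /psi_ker /(_ (p *: ('X *: w))) Qp]] := exists_annihilator psiL ('X *: w).
(* Write q as q' X + c, so that q X w = X (q' X w + c w). The part c w lies in the radical, so the
   shift identity gives the value for q' minus a square; when q' = 0 this is - c^2 |b w|^2 < 0. *)
have key q : q != 0 -> Q (q *: ('X *: w)) (q *: ('X *: w)) < 0.
  have [n] := ubnP (size q); elim: n q => // n IH q.
  elim/poly_ind: q => [|q c _] sq q0; first by rewrite eqxx in q0.
  have -> : (q * 'X + c%:P) *: ('X *: w) = 'X *: (q *: ('X *: w) + c%:P *: w).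
    by rewrite scalerDl scalerDr -!scalerA; congr (_ + _); rewrite !scalerA;
      congr (_ *: _); rewrite mulrC // -mulrA.
  have Qe : Q (q *: ('X *: w) + c%:P *: w) (q *: ('X *: w) + c%:P *: w) =
     Q (q *: ('X *: w)) (q *: ('X *: w)).
    have rcw : rad (c%:P *: w) by move=> v; rewrite QlZ rw mulr0.
    by rewrite QlD rcw addr0 QC QlD rcw addr0.
  rewrite QX Qe; set B := b _.
  have [qz|qn] := eqVneq q 0; last first.
    apply: (@le_lt_trans _ _ (Q (q *: ('X *: w)) (q *: ('X *: w)))).
      by rewrite gerDl oppr_le0 dotv_ge0.
    by apply: IH => //; move: sq; rewrite size_MXaddC (negPf qn).
  rewrite qz scale0r Ql0 sub0r oppr_lt0 lt_neqAle dotv_ge0 andbT eq_sym.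
  apply/eqP => /dotv_eq0; rewrite /B qz scale0r add0r (rlinZ bL) => /eqP.
  rewrite scaler_eq0 (negPf bw0) orbF => /eqP c0.
  by rewrite qz c0 mul0r add0r eqxx in q0.
by have := key _ p0; rewrite Qp ltxx.
Qed.

(** Split v = a + X v'. Since b w = 0, X w is orthogonal to the constant a, and Q(X w, X v') = Q(w,
    v') = 0. *)
Let rad_X w : rad w -> rad ('X *: w).
Proof.
move=> rw v; have [a [v' [-> h]]] := QX_const v.
have bw := rad_b rw.
by rewrite QC QlD QC h // add0r QC QX rw bw dotv0l subr0.
Qed.

Let rad_Xn n w : rad w -> rad ('X^n *: w).
Proof.
move=> rw; elim: n => [|n IH]; first by rewrite expr0 scale1r.
by rewrite exprS -scalerA; exact: rad_X.
Qed.

Let rad_poly p w : rad w -> rad (p *: w).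
Proof.
move=> rw; elim/poly_ind: p => [|p c IH]; first by rewrite scale0r => v; rewrite Ql0.
rewrite scalerDl mulrC -scalerA; apply: radD; first exact: rad_X.
by move=> v; rewrite QlZ rw mulr0.
Qed.

Let b_poly p w : (forall k, b ('X^k *: w) = 0) -> forall k, b ('X^k *: (p *: w)) = 0.
Proof.
move=> h k; rewrite scalerA (rlin_poly bL _ (leqnn _)) big1 // => i _.
by rewrite h scaler0.
Qed.

Let QXn n u v : (forall k, b ('X^k *: u) = 0) -> Q ('X^n *: u) ('X^n *: v) = Q u v.
Proof.
move=> h; elim: n => [|n IH]; first by rewrite expr0 !scale1r.
by rewrite exprS -!scalerA QX IH h dotv0l subr0.
Qed.

(* A relation p(X) w = 0 modulo the radical may be divided by powers of X and
   normalized to w = X r(X) w, hence w = X^n r(X)^n w for all n. *)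
Let rad_unobservable w : (forall k, b ('X^k *: w) = 0) -> rad w.
Proof.
move=> bw; have [p [p0 _ pw]] := exists_annihilator psiL w.
have rp : rad (p *: w) by exact: psi_ker.
have [q q0 rq] : exists2 q : {poly R}, q`_0 != 0 & rad (q *: w).
  have [n] := ubnP (size p); elim: n p p0 rp {pw} => // n IH p p0 rp sp.
  have [pz|pn] := eqVneq p`_0 0; last by exists p.
  have /factor_theorem[s ps] : root p 0 by rewrite /root horner_coef0 pz.
  rewrite polyC0 subr0 in ps.
  have s0 : s != 0 by apply: contra p0 => /eqP s0; rewrite ps s0 mul0r.
  apply: (IH s) => //; last first.
    by move: sp; rewrite ps size_mulX // ltnS.
  (* Multiplication by X preserves Q on the unobservable s w, so Q(s w, v) = Q(p w, X v) = 0. *)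
  move=> v; rewrite -(@QXn 1) ?expr1; last exact: b_poly.
  by rewrite scalerA mulrC -ps rp.
pose q1 := (q`_0)^-1 *: q.
have [r qr] : exists r, q1 = 1 - r * 'X.
  have /factor_theorem[s ps] : root (1 - q1) 0.
    by rewrite /root horner_coef0 coefB coef1 coefZ mulVf // subrr.
  by exists s; move: ps; rewrite polyC0 subr0 => <-; rewrite opprB addrC subrK.
have rq1 : rad (w - ('X * r) *: w).
  have -> : w - ('X * r) *: w = q1 *: w by rewrite qr scalerBl scale1r mulrC.
  by rewrite /q1 -mul_polyC -scalerA => v; rewrite QlZ rq mulr0.
have rn n : rad (w - ('X^n * r ^+ n) *: w).
  elim: n => [|n IH]; first by rewrite !expr0 mulr1 scale1r subrr => v; rewrite Ql0.
  have -> : w - ('X^(n.+1) * r ^+ n.+1) *: w =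
     (w - ('X * r) *: w) + ('X * r) *: (w - ('X^n * r ^+ n) *: w).
    rewrite scalerBr addrA subrK scalerA; congr (_ - _ *: _).
    by rewrite !exprS; ring.
  by apply: radD => //; exact: rad_poly.
(* For n large in terms of v, the representative X^n r^n w of w modulo the radical is orthogonal to
   v. *)
move=> v; have [n h] := QXn0 v; have := rn n v.
rewrite QlB => /eqP; rewrite subr_eq0 => /eqP ->.
rewrite -scalerA; apply: h; exact: b_poly.
Qed.

(** A relation p(X) w in the radical, of degree d <= t, stays there after multiplication by powers
    of X and is killed by b. This is a linear recurrence of order d for b(X^k w) with nonzero
    leading coefficient, so t initial zeros propagate to all k. *)
Let rad_window w : (forall k, (k < t)%N -> b ('X^k *: w) = 0) -> rad w.
Proof.
move=> bw; have [p [p0 sp pw]] := exists_annihilator psiL w.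
have rp : rad (p *: w) by exact: psi_ker.
have pS : size p = (size p).-1.+1 by rewrite prednK // lt0n size_poly_eq0.
set d := (size p).-1 in pS.
have dt : (d <= t)%N by rewrite -ltnS -pS.
apply: rad_unobservable => k; elim/ltn_ind: k => k IH.
have [/bw//|tk] := ltnP k t.
have dk : (d <= k)%N by exact: leq_trans tk.
have := rad_b (rad_Xn (k - d) rp).
rewrite scalerA mulrC -scalerA (rlin_poly bL _ (leqnn _)) pS big_ord_recr /=.
rewrite big1 => [|i _]; last first.
  rewrite scalerA -exprD IH ?scaler0 //.
  by rewrite addnC -ltn_subRL subKn.
rewrite add0r scalerA -exprD subnKC // => /eqP; rewrite scaler_eq0.
by rewrite -lead_coefE lead_coef_eq0 (negPf p0) => /eqP.
Qed.

(** The observability map, whose kernel lies in the radical by [rad_window]; hence Q factors through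
    its finite-dimensional image. *)
Let window u : 'rV[R]_(t * M) := mxvec (\matrix_(n < t) b ('X^n *: u)).

Let windowL : real_linear window.
Proof.
move=> c u v; rewrite /window -linearP; congr mxvec.
apply/row_matrixP => n; rewrite [RHS]linearP /= !rowK scalerDr rlinD //.
by rewrite scalerA mulrC -scalerA rlinZ.
Qed.

Let window_norm u :
  dotv (window u) (window u) = \sum_(n < t) dotv (b ('X^n *: u)) (b ('X^n *: u)).
Proof.
rewrite dotvE (reindex _ (curry_mxvec_bij _ _)) /=.
rewrite (eq_bigr (fun n : 'I_t => \sum_i b ('X^n *: u) 0 i * b ('X^n *: u) 0 i)).
  by rewrite pair_bigA /=; apply: eq_bigr => -[i j] _; rewrite /= mxvecE mxE.
by move=> n _; rewrite dotvE.
Qed.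

Let window_bound : exists2 C, 0 < C & forall u,
  - Q u u <= C * \sum_(n < t) dotv (b ('X^n *: u)) (b ('X^n *: u)).
Proof.
have [r [e span]] := finite_row_span window.
set A := \matrix_i window (e i) in span.
pose G : 'M[R]_r := \matrix_(i, j) Q (e i) (e j).
have [C C0 CP] := quadratic_form_bound (pinvmx A *m G *m (pinvmx A)^T).
exists C => // u; rewrite -window_norm.
apply: le_trans (CP (window u)); rewrite -normrN; apply: le_trans (ler_norm _).
rewrite lerN2 le_eqVlt; apply/orP; left; apply/eqP.
(* w is the combination of the e i with the same window as u, so u - w is radical and Q(u, u) = Q(w,
   w) is a quadratic form in the window of u. *)
pose c := window u *m pinvmx A; pose w := \sum_i (c 0 i)%:P *: e i.
have rw : rad (u - w).
  have wu : window (u - w) = 0.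
    rewrite (rlinB windowL) (rlin_sum windowL) -(mulmxKpV (span u)) -/c.
    rewrite mulmx_sum_row -sumrB big1 // => i _.
    by rewrite rlinZ // rowK subrr.
  apply: rad_window => k kt; have := congr1 vec_mx wu.
  rewrite mxvecK raddf0 => /row_matrixP /(_ (Ordinal kt)).
  by rewrite rowK row0.
have Qu v : Q u v = Q w v by apply/eqP; rewrite -subr_eq0 -QlB rw.
rewrite Qu QC Qu.
have -> : window u *m (pinvmx A *m G *m (pinvmx A)^T) *m (window u)^T = c *m G *m c^T.
  by rewrite /c; move: (pinvmx A) => B; rewrite trmx_mul !mulmxA.
rewrite {1}/w (rlin_sum (QL _)) mxE; apply: eq_bigr => j _.
rewrite QlZ mulrC QC (rlin_sum (QL _)) !mxE; congr (_ * _).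
by apply: eq_bigr => i _; rewrite QlZ !mxE.
Qed.

Theorem shift_form_ge0 u : 0 <= Q u u.
Proof.
have [C C0 CP] := window_bound; rewrite -oppr_le0.
pose d n := dotv (b ('X^n *: u)) (b ('X^n *: u)).
have := @growth_le0 _ (fun n => - Q ('X^n *: u) ('X^n *: u)) d t C^-1.
rewrite /= expr0 scale1r; apply.
- by move=> n; rewrite exprS -scalerA QX opprB addrC.
- by move=> n; exact: dotv_ge0.
- by rewrite invr_gt0.
- move=> n; rewrite ler_pdivrMl //; apply: (le_trans (CP _)); rewrite ler_pM2l //.
  by rewrite le_eqVlt; apply/orP; left; apply/eqP/eq_bigr => j _;
    rewrite /d exprD mulrC -scalerA.
- by move=> r r0 r1; exact: b_subexp.
Qed.

End ShiftForm.

(** * Real power series on the interval (0, 1) *)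

Section PowerSeries.
Variable R : realType.
Implicit Types (a b : nat -> R) (x y f g r : R).

Definition psum a x f := series (fun n => a n * x ^+ n) @ \oo --> f.

Definition conv (K : pzRingType) (a b : nat -> K) n :=
  \sum_(k < n.+1) a k * b (n - k)%N.

Lemma psumD a b x f g : psum a x f -> psum b x g ->
  psum (fun n => a n + b n) x (f + g).
Proof.
move=> af bg; rewrite /psum [X in X @ _ --> _](_ : _ =
  series (fun n => a n * x ^+ n) + series (fun n => b n * x ^+ n)).
  exact: cvgD.
apply/funext => n; rewrite fctE !seriesEord /= -big_split.
by apply: eq_bigr => i _; rewrite mulrDl.
Qed.

Lemma psumZ c a x f : psum a x f -> psum (fun n => c * a n) x (c * f).
Proof.
move=> af; rewrite /psum [X in X @ _ --> _](_ : _ =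
  (fun n => c * series (fun n => a n * x ^+ n) n)); first exact: cvgMl_tmp.
apply/funext => n; rewrite !seriesEord /= mulr_sumr.
by apply: eq_bigr => i _; rewrite mulrA.
Qed.

Lemma psum_sum (I : Type) (s : seq I) (a : I -> nat -> R) x (f : I -> R) :
  (forall i, psum (a i) x (f i)) ->
  psum (fun n => \sum_(i <- s) a i n) x (\sum_(i <- s) f i).
Proof.
move=> af; elim: s => [|i s IH].
  rewrite big_nil /psum (_ : series _ = fun=> 0); first exact: cvg_cst.
  by apply/funext => n; rewrite seriesEord /= big1 // => i _; rewrite big_nil mul0r.
rewrite big_cons (_ : (fun n => _) = fun n => a i n + \sum_(i <- s) a i n).
  exact: psumD.
by apply/funext => n; rewrite big_cons.
Qed.

Lemma psum_poly (p : {poly R}) x : psum (fun n => p`_n) x p.[x].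
Proof.
rewrite /psum; apply: cvg_near_cst.
exists (size p) => // n /= pn; rewrite seriesEord /= (@horner_coef_wide _ n) //.
Qed.

Lemma psum_geometric x y : 0 < x -> x < 1 -> 0 < y -> y < 1 ->
  psum (fun n => y ^+ n) x (1 - x * y)^-1.
Proof.
move=> x0 x1 y0 y1; rewrite /psum -[_^-1]mul1r.
rewrite [X in series X](_ : _ = geometric 1 (x * y)).
  by apply: cvg_geometric_series; rewrite gtr0_norm ?mulr_gt0 //; nra.
by apply/funext => n; rewrite /= mul1r exprMn mulrC.
Qed.

Lemma psum_bounded a x f : 0 < x -> psum a x f ->
  exists2 C, 0 < C & forall n, `|a n| * x ^+ n <= C.
Proof.
move=> x0 af; have := cvg_series_cvg_0 (cvgP _ af) => h.
have [C [_ CP]] := cvg_seq_bounded (cvgP _ h).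
have C0 : 0 < `|C| + 1 by rewrite ltr_wpDl.
exists (`|C| + 1) => // n.
have -> : `|a n| * x ^+ n = `|a n * x ^+ n|.
  by rewrite normrM (ger0_norm (exprn_ge0 _ (ltW x0))).
by apply: CP; rewrite // (le_lt_trans (ler_norm C)) // ltrDl.
Qed.

(** Convergence at some r > x bounds both coefficient sequences by multiples of r^-n. With x = r
    s^2, one factor s^n absorbs the n + 1 terms of the Cauchy product and the other leaves a
    geometric tail. *)
Lemma psum_conv a b (f g : R -> R) :
  (forall x, 0 < x -> x < 1 -> psum a x (f x)) ->
  (forall x, 0 < x -> x < 1 -> psum b x (g x)) ->
  forall x, 0 < x -> x < 1 -> psum (conv a b) x (f x * g x).
Proof.
move=> af bg x x0 x1.
have [s [s0 s1 xs]] : exists s, [/\ 0 < s, s < 1 & x < s ^+ 2].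
  (* The square of this s exceeds x by ((1 - x) / 2)^2. *)
  exists ((1 + x) / 2); split; [lra|lra|].
  by rewrite expr2; nra.
have [r [r0 r1 xr]] : exists r, [/\ 0 < r, r < 1 & x = r * s * s].
  have s20 : 0 < s ^+ 2 by rewrite exprn_gt0.
  exists (x / s ^+ 2); split; first by rewrite divr_gt0.
    by rewrite ltr_pdivrMr // mul1r.
  by rewrite -mulrA -expr2 divfK // lt0r_neq0.
have [A A0 aA] := psum_bounded r0 (af r r0 r1).
have [B B0 bB] := psum_bounded r0 (bg r r0 r1).
(* Bernoulli's inequality for s^-1 *)
have [D D0 sD] : exists2 D, 0 < D & forall n, n.+1%:R * s ^+ n <= D.
  pose h := s^-1 - 1; have h0 : 0 < h by rewrite subr_gt0 invf_gt1.
  exists (1 + h^-1); first by rewrite ltr_wpDr ?invr_ge0 // ltW.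
  move=> n; have := bernoulli_geD1 n (ltW h0).
  rewrite (_ : 1 + h = s^-1) ?subrKC // exprVn => hn.
  rewrite -ler_pdivlMr ?exprn_gt0 //.
  apply: (@le_trans _ _ ((1 + h^-1) * (1 + n%:R * h))).
    have -> : (1 + h^-1) * (1 + n%:R * h) = 1 + n%:R * h + h^-1 + n%:R.
      by field; rewrite lt0r_neq0.
    rewrite -natr1.
    have : 0 <= n%:R * h by rewrite mulr_ge0 // ltW.
    have : 0 < h^-1 by rewrite invr_gt0.
    lra.
  by rewrite ler_pM2l // ltr_wpDr ?invr_ge0 // ltW.
(* The product of the partial sums of length L is the value of p L * q L. Its first L coefficients
   are those of the Cauchy product; the next L form an error of order s^L. *)
pose p L := \poly_(k < L) a k; pose q L := \poly_(k < L) b k.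
pose c L n := (p L * q L)`_n.
have cE L n : (n < L)%N -> c L n = conv a b n.
  move=> nL; rewrite /c coefM; apply: eq_bigr => k _; rewrite !coef_poly.
  have kL : (k < L)%N by rewrite (leq_ltn_trans _ nL) // -ltnS.
  by rewrite kL (leq_ltn_trans (leq_subr _ _) nL).
have cB L n : `|c L n| * x ^+ n <= A * B * D * s ^+ n.
  apply: (@le_trans _ _ (A * B * (n.+1%:R * s ^+ n) * s ^+ n)); last first.
    by rewrite ler_wpM2r ?exprn_ge0 ?(ltW s0) // ler_wpM2l ?mulr_ge0 ?(ltW A0) ?(ltW B0).
  rewrite xr !exprMn !mulrA ler_wpM2r ?exprn_ge0 ?(ltW s0) //.
  rewrite ler_wpM2r ?exprn_ge0 ?(ltW s0) //.
  rewrite /c coefM (le_trans (ler_wpM2r _ (ler_norm_sum _ _ _))) ?exprn_ge0 ?(ltW r0) //.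
  rewrite mulr_suml mulr_natr -[n.+1 in leRHS]card_ord -sumr_const ler_sum // => k _.
  rewrite !coef_poly normrM -[in r ^+ n](@subnKC k n) ?exprD; last by rewrite -ltnS.
  rewrite mulrACA ler_pM ?mulr_ge0 ?exprn_ge0 ?(ltW r0) //.
    by case: ifP; rewrite // normr0 mul0r ltW.
  by case: ifP; rewrite // normr0 mul0r ltW.
pose SA := series (fun n => a n * x ^+ n); pose SB := series (fun n => b n * x ^+ n).
have key L : `|series (fun n => conv a b n * x ^+ n) L - SA L * SB L| <=
   A * B * D / (1 - s) * s ^+ L.
  have -> : SA L * SB L = \sum_(n < L + L) c L n * x ^+ n.
    rewrite -horner_coef_wide; last first.
      by rewrite (leq_trans (size_polyMleq _ _)) // (leq_trans (leq_pred _)) // leq_add // size_poly.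
    rewrite hornerM; congr (_ * _); rewrite /SA /SB seriesEord /= horner_poly //.
  rewrite seriesEord /= big_split_ord /= opprD addrA.
  rewrite [X in `|X - _ + _|](_ : _ = \sum_(n < L) c L n * x ^+ n); last first.
    by apply: eq_bigr => n _; rewrite cE.
  rewrite subrr sub0r normrN (le_trans (ler_norm_sum _ _ _)) //.
  apply: (@le_trans _ _ (\sum_(n < L) A * B * D * s ^+ L * s ^+ n)).
    apply: ler_sum => n _; rewrite normrM (ger0_norm (exprn_ge0 _ (ltW x0))).
    by apply: le_trans (cB _ _) _; rewrite exprD mulrA.
  rewrite -mulr_sumr [leRHS]mulrAC ler_wpM2l ?mulr_ge0 ?exprn_ge0 ?(ltW s0) ?(ltW A0) ?(ltW B0) ?(ltW D0) //.
  rewrite -[leRHS]mul1r ler_pdivlMr ?subr_gt0 // mulrC.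
  by rewrite -[1 - s]opprB mulNr -subrX1 opprB gerBl exprn_ge0 // ltW.
have lim0 : series (fun n => conv a b n * x ^+ n) - (SA * SB) @ \oo --> (0 : R).
  apply: norm_cvg0; apply: (@squeeze_cvgr _ _ _ _ (fun=> 0)
     (fun L => A * B * D / (1 - s) * s ^+ L)).
  - by apply: nearW => L; rewrite normr_ge0 /=; exact: key.
  - exact: cvg_cst.
  - by apply: cvg_geometric; rewrite gtr0_norm.
have := cvgD lim0 (cvgM (af x x0 x1) (bg x x0 x1)).
by rewrite subrK add0r; apply.
Qed.

Lemma psum_shift a x : 0 < x -> a 0%N = 0 -> psum a x 0 ->
  psum (fun n => a n.+1) x 0.
Proof.
move=> x0 a0 ax; have := psumZ (c := x^-1) ax.
rewrite mulr0 /psum -cvg_shiftS => h.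
rewrite (_ : series _ = fun n => series (fun n => x^-1 * a n * x ^+ n) n.+1) //.
apply/funext => n; rewrite /= !seriesEord /= big_ord_recl.
rewrite a0 mulr0 mul0r add0r; apply: eq_bigr => i _.
by rewrite /= /bump /= exprS; field; rewrite lt0r_neq0.
Qed.

(** The point 0 is not in the hypothesis, so a 0 is reached as a limit: convergence at 1/2 makes the
    rest of the series O(x) as x tends to 0. *)
Lemma psum_eq0_head a : (forall x, 0 < x -> x < 1 -> psum a x 0) -> a 0%N = 0.
Proof.
move=> ax; have h2 : 0 < 2^-1 :> R by lra.
have [|C C0 aC] := psum_bounded h2 (ax _ h2 _); first lra.
(* From |a n| <= C 2^n and 2 x < 1/2, the terms after a 0 are at most 2 C x 2^-n. *)
have small x : 0 < x -> x < 4^-1 -> `|a 0%N| <= 4 * C * x.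
  move=> x0 x4; have x1 : x < 1 by lra.
  have ub L : `|series (fun n => a n * x ^+ n) L.+1 - a 0%N| <= 4 * C * x.
    rewrite seriesEord /= big_ord_recl expr0 mulr1 addrC addKr.
    rewrite (le_trans (ler_norm_sum _ _ _)) //.
    apply: (@le_trans _ _ (\sum_(n < L) 2 * C * x * 2^-1 ^+ n)).
      apply: ler_sum => n _; rewrite /= /bump /= normrM (ger0_norm (exprn_ge0 _ (ltW x0))).
      have -> : `|a n.+1| * x ^+ n.+1 = `|a n.+1| * 2^-1 ^+ n.+1 * (2 * x) ^+ n.+1.
        by rewrite -mulrA -exprMn mulrA mulVf // mul1r.
      have -> : 2 * C * x * 2^-1 ^+ n = C * (2 * x * 2^-1 ^+ n) by ring.
      apply: ler_pM; rewrite ?mulr_ge0 ?exprn_ge0 //; try lra.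
      rewrite exprS ler_wpM2l //; first lra.
      by apply: lerXn2r; rewrite ?nnegrE; lra.
    rewrite -mulr_sumr; have : \sum_(n < L) 2^-1 ^+ n <= 2 :> R.
      have := subrX1 (2^-1 : R) L; have : 0 <= 2^-1 ^+ L :> R by rewrite exprn_ge0.
      lra.
    have : 0 < C * x by rewrite mulr_gt0.
    nra.
  have lim : (fun L => `|series (fun n => a n * x ^+ n) L.+1 - a 0%N|) @ \oo --> `|0 - a 0%N|.
    have := ax x x0 x1; rewrite /psum -cvg_shiftS => h.
    exact: (cvg_norm (cvgB h (cvg_cst (a 0%N)))).
  rewrite sub0r normrN in lim.
  by apply: (cvgr_to_le lim); apply: nearW => L; exact: ub.
apply/eqP; rewrite -normr_le0 leNgt; apply/negP => a0.
(* This makes 4 C x at most half of |a 0|. *)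
pose x := Num.min (8^-1) (`|a 0%N| / (8 * C)).
have x0 : 0 < x by rewrite lt_min divr_gt0 ?mulr_gt0 // andbT; lra.
have x4 : x < 4^-1 by rewrite gt_min; apply/orP; left; lra.
have := small x x0 x4; rewrite leNgt => /negP; apply.
apply: (@le_lt_trans _ _ (4 * C * (`|a 0%N| / (8 * C)))).
  by rewrite ler_pM2l ?mulr_gt0 // ge_min lexx orbT.
have -> : 4 * C * (`|a 0%N| / (8 * C)) = `|a 0%N| / 2.
  by field; rewrite lt0r_neq0.
lra.
Qed.

(** The identity theorem that turns equalities between functions on (0, 1) into equalities between
    Taylor coefficients. *)
Lemma psum_eq0 a : (forall x, 0 < x -> x < 1 -> psum a x 0) -> forall n, a n = 0.
Proof.
move=> ax n; elim: n a ax => [|n IH] a ax; first exact: psum_eq0_head.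
apply: (IH (fun n => a n.+1)) => x x0 x1.
by apply: psum_shift => //; [exact: psum_eq0_head|exact: ax].
Qed.

End PowerSeries.

(** * Polynomials as finitely supported sequences *)

Section Pairing.
Variable R : realFieldType.
Implicit Types (p q : {poly R}) (a s : nat -> R).

(** Since p has finite support, it pairs with an arbitrary sequence a; multiplication by X is then
    the forward shift and [pairingX] gives its adjoint. *)
Definition pairing p a := \sum_(n < size p) p`_n * a n.

Lemma pairingE L p a : (size p <= L)%N -> pairing p a = \sum_(n < L) p`_n * a n.
Proof.
move=> pL; rewrite /pairing (big_ord_widen_cond L predT (fun n => p`_n * a n)) //.
rewrite big_mkcond /=; apply: eq_bigr => n _.
by case: ltnP => // h; rewrite nth_default ?mul0r.
Qed.

Lemma pairingL c p q a : pairing (c%:P * p + q) a = c * pairing p a + pairing q a.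
Proof.
pose L := maxn (maxn (size p) (size q)) (size (c%:P * p + q)).
rewrite !(@pairingE L) /L ?leq_max ?leqnn ?orbT //.
rewrite mulr_sumr -big_split; apply: eq_bigr => n _.
by rewrite coefD coefCM mulrDl mulrA.
Qed.

Lemma pairing0 a : pairing 0 a = 0.
Proof. by rewrite /pairing size_poly0 big_ord0. Qed.

Lemma pairingD p q a : pairing (p + q) a = pairing p a + pairing q a.
Proof. by rewrite -[p]mul1r -polyC1 pairingL !mul1r. Qed.

Lemma pairing_suml (I : Type) (r : seq I) (p : I -> {poly R}) a :
  pairing (\sum_(i <- r) p i) a = \sum_(i <- r) pairing (p i) a.
Proof. exact: (big_morph (pairing^~ a) (fun p q => pairingD p q a) (pairing0 a)). Qed.

Lemma eq_pairing p a s : a =1 s -> pairing p a = pairing p s.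
Proof. by move=> h; apply: eq_bigr => n _; rewrite h. Qed.

Lemma pairing_r0 p a : (forall n, a n = 0) -> pairing p a = 0.
Proof. by move=> h; rewrite /pairing big1 // => n _; rewrite h mulr0. Qed.

Lemma pairingZr c p a : pairing p (fun n => c * a n) = c * pairing p a.
Proof. by rewrite mulr_sumr; apply: eq_bigr => n _; rewrite mulrCA. Qed.

Lemma pairingBr p a s : pairing p (fun n => a n - s n) = pairing p a - pairing p s.
Proof. by rewrite -sumrB; apply: eq_bigr => n _; rewrite mulrBr. Qed.

Lemma pairing_sumr (I : Type) (r : seq I) p (a : I -> nat -> R) :
  pairing p (fun n => \sum_(i <- r) a i n) = \sum_(i <- r) pairing p (a i).
Proof. by rewrite exchange_big; apply: eq_bigr => n _; rewrite mulr_sumr. Qed.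

Lemma pairingX p a : pairing ('X * p) a = pairing p (fun n => a n.+1).
Proof.
rewrite (@pairingE (size p).+1) ?big_ord_recl; last first.
  by rewrite mulrC (leq_trans (size_polyMleq _ _)) // size_polyX addn2.
rewrite coefXM mul0r add0r; apply: eq_bigr => n _.
by rewrite coefXM.
Qed.

Lemma pairingC c a : pairing c%:P a = c * a 0%N.
Proof.
by rewrite (@pairingE 1) ?size_polyC_leq1 // big_ord1 coefC.
Qed.

Lemma pairing_horner p y : pairing p (fun n => y ^+ n) = p.[y].
Proof. by rewrite horner_coef. Qed.

Lemma pairing_sym p q : pairing p (nth 0 q) = pairing q (nth 0 p).
Proof.
rewrite !(@pairingE (maxn (size p) (size q))) ?leq_max ?leqnn ?orbT //.
by apply: eq_bigr => n _; rewrite mulrC.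
Qed.

Lemma pairingXn0 n p q : (size q <= n)%N -> pairing ('X^n * p) (nth 0 q) = 0.
Proof.
move=> qn; rewrite /pairing big1 // => i _; rewrite coefXnM.
by case: ltnP => [_|ni]; rewrite ?mul0r // [q`_i]nth_default ?mulr0 // (leq_trans qn).
Qed.

(* The adjoint of multiplication by the power series with coefficients s. *)
Definition bshift s p : {poly R} := \poly_(k < size p)
  pairing p (fun n => if (k <= n)%N then s (n - k)%N else 0).

Lemma coef_bshift s p k :
  (bshift s p)`_k = pairing p (fun n => if (k <= n)%N then s (n - k)%N else 0).
Proof.
rewrite coef_poly; case: ltnP => // pk; rewrite /pairing big1 // => n _.
by rewrite leqNgt (leq_trans (ltn_ord n) pk) mulr0.
Qed.

Lemma bshiftL s c p q : bshift s (c%:P * p + q) = c%:P * bshift s p + bshift s q.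
Proof. by apply/polyP => k; rewrite coefD coefCM !coef_bshift pairingL. Qed.

(** T^* commutes with the shift up to one new entry at index 0. This defect is the source of the map
    b and of the shift identity. *)
Lemma bshiftX s p :
  bshift s ('X * p) = 'X * bshift s p + (pairing p (fun n => s n.+1))%:P.
Proof.
apply/polyP => k; rewrite coefD coefXM coefC !coef_bshift pairingX.
case: k => [|k] /=; first by rewrite add0r; apply: eq_pairing => n; rewrite subn0.
by rewrite addr0; apply: eq_pairing => n; rewrite ltnS subSS.
Qed.

Lemma bshiftC s c : bshift s c%:P = (c * s 0%N)%:P.
Proof.
apply/polyP => k; rewrite coef_bshift pairingC coefC.
by case: k => [|k] //=; rewrite mulr0.
Qed.

(** The adjunction between T^* and T: [conv a s] is T applied to a, with a finite sum in each entry
    even when a has infinite support. *)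
Lemma pairing_bshift s p a : pairing (bshift s p) a = pairing p (conv a s).
Proof.
rewrite (@pairingE (size p)) ?size_poly //.
under eq_bigr => k _ do rewrite coef_bshift mulr_suml.
rewrite exchange_big; apply: eq_bigr => n _; rewrite /conv mulr_sumr.
rewrite (big_ord_widen_cond (size p) predT (fun k => p`_n * (a k * s (n - k)%N))) //.
rewrite [RHS]big_mkcond; apply: eq_bigr => k _ /=.
by rewrite ltnS; case: ifP => _; rewrite ?mulr0 ?mul0r // -mulrA [s _ * _]mulrC.
Qed.

End Pairing.

(** * Geometric bounds on sequences *)

Section Bounded.
Variable R : realFieldType.
Implicit Types (a : nat -> R) (r : R).

Definition geometrically_bounded r a := exists C, forall n, `|a n| * r ^+ n <= C.

Lemma geometrically_bounded_sum (I : Type) (s : seq I) r (a : I -> nat -> R) :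
  0 < r -> (forall i, geometrically_bounded r (a i)) ->
  geometrically_bounded r (fun n => \sum_(i <- s) a i n).
Proof.
move=> r0 ha; elim: s => [|i s [C hC]].
  by exists 0 => n; rewrite big_nil normr0 mul0r.
have [D hD] := ha i; exists (D + C) => n; rewrite big_cons.
apply: le_trans (lerD (hD n) (hC n)); rewrite -mulrDl ler_wpM2r ?exprn_ge0 ?(ltW r0) //.
exact: ler_normD.
Qed.

Lemma geometrically_boundedZ c r a : geometrically_bounded r a ->
  geometrically_bounded r (fun n => c * a n).
Proof.
by move=> [C hC]; exists (`|c| * C) => n; rewrite normrM -mulrA ler_wpM2l.
Qed.

Lemma geometrically_bounded_shift m r a : 0 < r -> geometrically_bounded r a ->
  geometrically_bounded r (fun n => a (m + n)%N).
Proof.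
move=> r0 [C hC]; exists (C / r ^+ m) => n.
by rewrite ler_pdivlMr ?exprn_gt0 // -mulrA -exprD addnC.
Qed.

Lemma geometrically_bounded_sqr r a : 0 < r -> geometrically_bounded r a ->
  geometrically_bounded (r ^+ 2) (fun n => a n * a n).
Proof.
move=> r0 [C hC]; exists (C * C) => n; rewrite normrM exprAC expr2 mulrACA.
by rewrite ler_pM // mulr_ge0 ?exprn_ge0 // ltW.
Qed.

End Bounded.

(** * The Toeplitz operator of a symbol with finite-rank kernel is a contraction *)

Section Toeplitz.
Variables (R : realType) (N M t : nat) (sg : nat -> 'M[R]_(N, M)).
Variables (F : R -> 'M[R]_(N, M)).
Variables (alpha : R -> 'rV[R]_N -> 'rV[R]_t) (E : R -> 'M[R]_(t, N)).
Hypothesis hF : forall x, 0 < x -> x < 1 -> forall i j,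
  psum (fun n => sg n i j) x (F x i j).
(** The kernel section at y in direction c has the coefficients alpha y c on the t rows of E. *)
Hypothesis hE : forall x y c, 0 < x -> x < 1 -> 0 < y -> y < 1 ->
  c - c *m F y *m (F x)^T = (1 - x * y) *: (alpha y c *m E x).

Let V : lmodType {poly R} := 'rV[{poly R}]_N.
Implicit Types u v w : V.

(* The adjoint T^* of the Toeplitz operator T with symbol F, so that defect is
   the form of I - T T^*. *)
Definition toeplitz u : 'rV[{poly R}]_M :=
  \row_j \sum_i bshift (fun n => sg n i j) (u 0 i).

Definition toeplitz_tail u : 'rV[R]_M :=
  \row_j \sum_i pairing (u 0 i) (fun n => sg n.+1 i j).

Definition poly_dot n (u v : 'rV[{poly R}]_n) : R :=
  \sum_i pairing (u 0 i) (nth 0 (v 0 i)).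

Definition defect u v := poly_dot u v - poly_dot (toeplitz u) (toeplitz v).

Lemma poly_dotC n (u v : 'rV[{poly R}]_n) : poly_dot u v = poly_dot v u.
Proof. by apply: eq_bigr => i _; rewrite pairing_sym. Qed.

Lemma poly_dotL n c (u v w : 'rV[{poly R}]_n) :
  poly_dot (c%:P *: u + v) w = c * poly_dot u w + poly_dot v w.
Proof.
rewrite /poly_dot mulr_sumr -big_split; apply: eq_bigr => i _.
by rewrite !mxE pairingL.
Qed.

Lemma poly_dotXC n (u v : 'rV[{poly R}]_n) (c d : 'rV[R]_n) :
  poly_dot ('X *: u + map_mx polyC c) ('X *: v + map_mx polyC d) =
  poly_dot u v + dotv c d.
Proof.
rewrite dotvE -big_split; apply: eq_bigr => i _.
rewrite !mxE pairingD pairingX pairingC coefD coefXM coefC add0r; congr (_ + _).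
by apply: eq_pairing => k; rewrite coefD coefXM coefC addr0.
Qed.

Lemma toeplitzL c u v : toeplitz (c%:P *: u + v) = c%:P *: toeplitz u + toeplitz v.
Proof.
apply/rowP => j; rewrite !mxE mulr_sumr -big_split; apply: eq_bigr => i _.
by rewrite !mxE bshiftL.
Qed.

Lemma toeplitzX u :
  toeplitz ('X *: u) = 'X *: toeplitz u + map_mx polyC (toeplitz_tail u).
Proof.
apply/rowP => j; rewrite !mxE mulr_sumr raddf_sum -big_split; apply: eq_bigr => i _.
by rewrite !mxE bshiftX.
Qed.

Lemma toeplitzC c :
  toeplitz (map_mx polyC c) = map_mx polyC (c *m sg 0%N).
Proof.
apply/rowP => j; rewrite !mxE raddf_sum; apply: eq_bigr => i _.
by rewrite !mxE bshiftC.
Qed.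

Lemma toeplitz_tailL : real_linear toeplitz_tail.
Proof.
move=> c u v; apply/rowP => j; rewrite !mxE mulr_sumr -big_split.
by apply: eq_bigr => i _; rewrite !mxE pairingL.
Qed.

Lemma defectC u v : defect u v = defect v u.
Proof. by rewrite /defect poly_dotC [X in _ - X]poly_dotC. Qed.

Lemma defectL v : real_linear (W := R^o) (defect^~ v).
Proof.
by move=> c u w; rewrite /defect toeplitzL !poly_dotL /GRing.scale /=; ring.
Qed.

Lemma defectX u v :
  defect ('X *: u) ('X *: v) = defect u v - dotv (toeplitz_tail u) (toeplitz_tail v).
Proof.
rewrite /defect !toeplitzX poly_dotXC.
have := poly_dotXC u v 0 0; rewrite dotv0l addr0 !map_mx0 !addr0 => ->.
by rewrite opprD addrA.
Qed.

(** Take for a the constant term of v. T^* maps constants to constants, while X w and, when b w = 0,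
    T^*(X w) = X T^* w have no constant term. *)
Lemma defectX_const v : exists a v', v = a + 'X *: v' /\
  forall w, toeplitz_tail w = 0 -> defect ('X *: w) a = 0.
Proof.
exists (map_mx polyC (\row_i (v 0 i)`_0)), (\row_i drop_poly 1 (v 0 i)); split.
  apply/rowP => i; rewrite !mxE; apply/polyP => k.
  rewrite coefD coefC coefXM coef_drop_poly.
  by case: k => [|k] /=; rewrite ?addr0 // add0r addn1.
move=> w bw; rewrite /defect toeplitzC toeplitzX bw.
have h n (x : 'rV_n) (c : 'rV[R]_n) : poly_dot ('X *: x) (map_mx polyC c) = 0.
  by have := poly_dotXC x 0 0 c; rewrite dotv0l map_mx0 scaler0 add0r !addr0
    => ->; rewrite poly_dotC /poly_dot big1 // => i _; rewrite mxE pairing0.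
by rewrite map_mx0 addr0 !h subrr.
Qed.

Lemma defectXn0 v : exists n, forall w,
  (forall k, toeplitz_tail ('X^k *: w) = 0) -> defect ('X^n *: w) v = 0.
Proof.
(* T^* commutes with X^n on w, so n only has to push the supports of X^n w and X^n T^* w beyond
   those of v and T^* v. *)
exists (\max_i size (v 0%R i) + \max_j size (toeplitz v 0%R j))%N => w bw.
set n := (_ + _)%N.
have -> : defect ('X^n *: w) v =
    poly_dot ('X^n *: w) v - poly_dot ('X^n *: toeplitz w) (toeplitz v).
  rewrite /defect; congr (_ - poly_dot _ _); elim: n => [|n IH].
    by rewrite expr0 !scale1r.
  by rewrite exprS -!scalerA toeplitzX IH bw map_mx0 addr0.
rewrite /poly_dot !big1 ?subrr // => i _; rewrite mxE pairingXn0 // /n.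
  by rewrite (leq_trans (@leq_bigmax _ (fun j => size (toeplitz v 0 j)) i)) // leq_addl.
by rewrite (leq_trans (@leq_bigmax _ (fun j => size (v 0 j)) i)) // leq_addr.
Qed.

Lemma toeplitz_tail_subexp u (r : R) : 0 < r -> r < 1 -> exists C, forall n,
  dotv (toeplitz_tail ('X^n *: u)) (toeplitz_tail ('X^n *: u)) * r ^+ n <= C.
Proof.
(* The entries of b(X^n u) are fixed combinations of Taylor coefficients of index above n, hence
   bounded by multiples of s^-n; squaring turns s into r. *)
move=> r0 r1; pose s := Num.sqrt r; have s0 : 0 < s by rewrite sqrtr_gt0.
have s2 : s ^+ 2 = r by rewrite sqr_sqrtr // ltW.
have s1 : s < 1.
  by rewrite -(@ltr_pXn2r _ 2) ?nnegrE ?(ltW s0) // expr1n s2.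
have bj j : geometrically_bounded s (fun n => toeplitz_tail ('X^n *: u) 0 j).
  have -> : (fun n => toeplitz_tail ('X^n *: u) 0 j) = fun n =>
      \sum_i \sum_(m < size (u 0 i)) (u 0 i)`_m * sg (m.+1 + n)%N i j.
    apply/funext => n; rewrite mxE; apply: eq_bigr => i _; rewrite mxE.
    have -> a : pairing ('X^n * u 0 i) a = pairing (u 0 i) (fun m => a (m + n)%N).
      elim: n a => [|n IH] a.
        by rewrite expr0 mul1r; apply: eq_pairing => m; rewrite addn0.
      rewrite exprS -mulrA pairingX IH; apply: eq_pairing => m.
      by rewrite addnS.
    by apply: eq_bigr => m _; rewrite addSn.
  apply: geometrically_bounded_sum => // i; apply: geometrically_bounded_sum => // m.
  apply: geometrically_boundedZ.
  apply: (@geometrically_bounded_shift _ m.+1 s (fun n => sg n i j)) => //.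
  by have [C _ hC] := psum_bounded s0 (@hF s s0 s1 i j); exists C.
have [C hC] : geometrically_bounded r
    (fun n => \sum_j toeplitz_tail ('X^n *: u) 0 j * toeplitz_tail ('X^n *: u) 0 j).
  apply: geometrically_bounded_sum => // j; rewrite -s2.
  exact: geometrically_bounded_sqr.
exists C => n; apply: le_trans (hC n).
by rewrite dotvE ler_wpM2r ?exprn_ge0 ?(ltW r0) // ler_norm.
Qed.

(* The power series coefficients of x |-> alpha y c *m E x. *)
Let g (y : R) (c : 'rV[R]_N) i n := c 0 i * y ^+ n -
  \sum_j (c *m F y) 0 j * conv (fun n => y ^+ n) (fun n => sg n i j) n.

(** Divide [hE] by 1 - x y: the geometric series in x y times F x becomes the convolution in [g]. *)
Let psum_g x y c i : 0 < x -> x < 1 -> 0 < y -> y < 1 ->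
  psum (g y c i) x ((alpha y c *m E x) 0 i).
Proof.
move=> x0 x1 y0 y1.
have xy : 1 - x * y != 0 by rewrite lt0r_neq0 // subr_gt0; nra.
have -> : (alpha y c *m E x) 0 i = c 0 i * (1 - x * y)^-1 +
   -1 * \sum_j (c *m F y) 0 j * ((1 - x * y)^-1 * F x i j).
  apply: (mulfI xy); transitivity (((1 - x * y) *: (alpha y c *m E x)) 0 i).
    by rewrite [RHS]mxE.
  have -> : ((1 - x * y) *: (alpha y c *m E x)) 0 i =
      c 0 i - \sum_j (c *m F y) 0 j * F x i j.
    rewrite -hE // mxE; congr (_ + _); rewrite mxE; congr (- _).
    by rewrite mxE; apply: eq_bigr => j _; rewrite [X in _ * X]mxE.
  rewrite mulrDr mulrCA divff // mulr1 mulN1r mulrN mulr_sumr.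
  congr (_ - _); apply: eq_bigr => j _.
  by rewrite [RHS]mulrCA [X in _ = _ * X]mulrA divff // mul1r.
have -> : g y c i = fun n => c 0 i * y ^+ n +
    -1 * \sum_j (c *m F y) 0 j * conv (fun n => y ^+ n) (fun n => sg n i j) n.
  by apply/funext => n; rewrite mulN1r.
apply: psumD; apply: psumZ; first exact: psum_geometric.
apply: psum_sum => j; apply: psumZ.
apply: (@psum_conv _ _ _ (fun x => (1 - x * y)^-1) (fun x => F x i j)) => // z z0 z1.
  exact: psum_geometric.
exact: hF.
Qed.

Let phi y c u := \sum_i pairing (u 0 i) (g y c i).

Let phiE y c u : phi y c u =
  \sum_i c 0 i * (u 0 i).[y] - \sum_j (c *m F y) 0 j * (toeplitz u 0 j).[y].
Proof.
rewrite /phi /g.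
under eq_bigr => i _.
  rewrite pairingBr pairingZr pairing_horner pairing_sumr.
  under eq_bigr => j _ do rewrite pairingZr -pairing_bshift pairing_horner.
  over.
rewrite sumrB; congr (_ - _); rewrite exchange_big; apply: eq_bigr => j _ /=.
by rewrite mxE [in RHS]mxE horner_sum mulr_sumr.
Qed.

Let defect_eq0 u : (forall y c, 0 < y -> y < 1 -> phi y c u = 0) ->
  forall v, defect u v = 0.
Proof.
move=> phi0 v.
have coef i n : (u 0 i)`_n - \sum_j conv (nth 0 (toeplitz u 0 j)) (fun n => sg n i j) n = 0.
  apply: (@psum_eq0 _ (fun n => (u 0 i)`_n -
     \sum_j conv (nth 0 (toeplitz u 0 j)) (fun n => sg n i j) n)) => y y0 y1.
  have e0 : (u 0 i).[y] + -1 * (\sum_j (toeplitz u 0 j).[y] * F y i j) = 0.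
    transitivity (phi y (delta_mx 0 i) u); last exact: phi0.
    rewrite phiE mulN1r; congr (_ - _).
      rewrite (bigD1 i) //= !mxE !eqxx mul1r big1 ?addr0 // => k ki.
      by rewrite mxE (negPf ki) andbF mul0r.
    by apply: eq_bigr => j _; rewrite -rowE [in RHS]mxE mulrC.
  rewrite -[X in psum _ _ X]e0 (_ : (fun n => _) = fun n => (u 0 i)`_n +
    -1 * \sum_j conv (nth 0 (toeplitz u 0 j)) (fun n => sg n i j) n); last first.
    by apply/funext => k; rewrite mulN1r.
  apply: psumD; first exact: psum_poly.
  apply: psumZ; apply: psum_sum => j.
  apply: (@psum_conv _ _ _ (fun x => (toeplitz u 0 j).[x]) (fun x => F x i j)) => // z z0 z1.
    exact: psum_poly.
  exact: hF.
rewrite defectC /defect /poly_dot.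
under [X in _ - X]eq_bigr => j _.
  rewrite [toeplitz v]/toeplitz mxE pairing_suml.
  under eq_bigr => i _ do rewrite pairing_bshift.
  over.
rewrite exchange_big -sumrB big1 // => i _; rewrite /= -pairing_sumr -pairingBr.
by apply: pairing_r0 => n; rewrite coef.
Qed.

Theorem toeplitz_contraction u :
  poly_dot (toeplitz u) (toeplitz u) <= poly_dot u u.
Proof.
pose T := {yc : R * 'rV[R]_N | 0 < yc.1 < 1}.
(* All alpha y c lie in dimension t, so finitely many pairs (y, c) span them; the corresponding
   [phi] form the finite-rank map psi. *)
have [r [e span]] := finite_row_span (fun z : T => alpha (val z).1 (val z).2).
pose psi u : 'rV[R]_r := \row_l phi (val (e l)).1 (val (e l)).2 u.
have psiL : real_linear psi.
  move=> c v w; apply/rowP => l; rewrite !mxE /phi mulr_sumr -big_split.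
  by apply: eq_bigr => i _; rewrite !mxE pairingL.
have psi_ker v : psi v = 0 -> forall w, defect v w = 0.
  move=> pv; apply: defect_eq0 => y c y0 y1.
  have yc : 0 < (y, c).1 < 1 by rewrite /= y0 y1.
  have := span (exist _ (y, c) yc); set A := (X in (_ <= X)%MS) => /submxP[d /= dA].
  (* A relation between the alpha gives the same relation between kernel sections, hence between
     their coefficients. *)
  have gE i n : g y c i n - \sum_l d 0 l * g (val (e l)).1 (val (e l)).2 i n = 0.
    apply: (@psum_eq0 _ (fun n => g y c i n -
      \sum_l d 0 l * g (val (e l)).1 (val (e l)).2 i n)) => x x0 x1.
    rewrite (_ : (fun n => _) = fun n => g y c i n +
      -1 * \sum_l d 0 l * g (val (e l)).1 (val (e l)).2 i n); last first.
      by apply/funext => k; rewrite mulN1r.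
    have e0 : 0 = (alpha y c *m E x) 0 i + -1 *
      \sum_l d 0 l * (alpha (val (e l)).1 (val (e l)).2 *m E x) 0 i.
      rewrite dA -mulmxA mulN1r [X in X - _]mxE -sumrB big1 // => l _.
      have <- : row l A = alpha (val (e l)).1 (val (e l)).2 by exact: rowK.
      by rewrite -mulrBr -row_mul [X in _ - X]mxE subrr mulr0.
    rewrite [X in psum _ _ X]e0; apply: psumD; first exact: psum_g.
    apply: psumZ; apply: psum_sum => l; apply: psumZ.
    by case/andP: (valP (e l)) => *; exact: psum_g.
  transitivity (\sum_l d 0 l * phi (val (e l)).1 (val (e l)).2 v).
    rewrite /phi; under [RHS]eq_bigr => l _ do rewrite mulr_sumr.
    rewrite exchange_big; apply: eq_bigr => i _ /=.
    under [RHS]eq_bigr => l _ do rewrite -pairingZr.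
    rewrite -pairing_sumr; apply: eq_pairing => n.
    by apply/eqP; rewrite -subr_eq0 gE.
  by rewrite big1 // => l _; have := congr1 (fun z : 'rV_r => z 0 l) pv;
    rewrite !mxE => ->; rewrite mulr0.
rewrite -subr_ge0.
exact: (shift_form_ge0 defectL defectC toeplitz_tailL psiL defectX psi_ker
  defectX_const defectXn0 toeplitz_tail_subexp).
Qed.

Corollary toeplitz_contraction_seq (U : nat -> 'rV[R]_N) (K L : nat) :
  \sum_(k < K) dotv (\sum_(n < L | (k <= n)%N) U n *m sg (n - k)%N)
                    (\sum_(n < L | (k <= n)%N) U n *m sg (n - k)%N) <=
  \sum_(n < L) dotv (U n) (U n).
Proof.
pose u : V := \row_i \poly_(n < L) U n 0 i.
have uE : poly_dot u u = \sum_(n < L) dotv (U n) (U n).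
  under [RHS]eq_bigr => n _ do rewrite dotvE.
  rewrite exchange_big; apply: eq_bigr => i _.
  rewrite !mxE (@pairingE _ L) ?size_poly //; apply: eq_bigr => n _.
  by rewrite coef_poly ltn_ord.
rewrite -uE; apply: le_trans (toeplitz_contraction u).
under eq_bigr => k _ do rewrite dotvE.
rewrite exchange_big; apply: ler_sum => j _ /=.
have tE k : (\sum_(n < L | (k <= n)%N) U n *m sg (n - k)%N) 0 j = (toeplitz u 0 j)`_k.
  rewrite mxE coef_sum summxE.
  under [RHS]eq_bigr => i _ do
    rewrite mxE coef_bshift (@pairingE _ L) ?size_poly //.
  rewrite exchange_big big_mkcond; apply: eq_bigr => n _ /=.
  case: ifP => _; last by rewrite big1 // => i _; rewrite mulr0.
  by rewrite mxE; apply: eq_bigr => i _; rewrite coef_poly ltn_ord.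
(* Both sums are brought to a common length; the entries from K on only add squares on the right. *)
rewrite (@pairingE _ (maxn K (size (toeplitz u 0 j)))) ?leq_maxr //.
rewrite (big_ord_widen_cond (maxn K (size (toeplitz u 0 j))) predT
  (fun k => (\sum_(n < L | (k <= n)%N) U n *m sg (n - k)%N) 0 j *
            (\sum_(n < L | (k <= n)%N) U n *m sg (n - k)%N) 0 j)) ?leq_maxl //.
rewrite big_mkcond /=; apply: ler_sum => k _; rewrite tE.
by case: ifP => // _; rewrite -expr2 sqr_ge0.
Qed.

End Toeplitz.

(** * Quaternions in real coordinates *)

Section QuaternionCoordinates.
Variable R : realType.
Implicit Types (x y : quat R) (a : R) (c : 'I_4).

Definition qcoord c x := nth 0 [:: qre x; qi x; qj x; qk x] c.

Lemma qcoordD c x y : qcoord c (x + y) = qcoord c x + qcoord c y.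
Proof. by case: c => -[|[|[|[|]]]]. Qed.

Lemma qcoord0 c : qcoord c 0 = 0.
Proof. by case: c => -[|[|[|[|]]]]. Qed.

Lemma qcoordN c x : qcoord c (- x) = - qcoord c x.
Proof. by case: c => -[|[|[|[|]]]]. Qed.

Lemma qcoord_sum c (I : Type) (r : seq I) (F : I -> quat R) :
  qcoord c (\sum_(i <- r) F i) = \sum_(i <- r) qcoord c (F i).
Proof. exact: (big_morph (qcoord c) (qcoordD c) (qcoord0 c)). Qed.

Lemma qre_sum (I : Type) (r : seq I) (F : I -> quat R) :
  qre (\sum_(i <- r) F i) = \sum_(i <- r) qre (F i).
Proof. exact: (@qcoord_sum (@Ordinal 4 0 isT)). Qed.

Lemma qi_sum (I : Type) (r : seq I) (F : I -> quat R) :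
  qi (\sum_(i <- r) F i) = \sum_(i <- r) qi (F i).
Proof. exact: (@qcoord_sum (@Ordinal 4 1 isT)). Qed.

Lemma qj_sum (I : Type) (r : seq I) (F : I -> quat R) :
  qj (\sum_(i <- r) F i) = \sum_(i <- r) qj (F i).
Proof. exact: (@qcoord_sum (@Ordinal 4 2 isT)). Qed.

Lemma qk_sum (I : Type) (r : seq I) (F : I -> quat R) :
  qk (\sum_(i <- r) F i) = \sum_(i <- r) qk (F i).
Proof. exact: (@qcoord_sum (@Ordinal 4 3 isT)). Qed.

Lemma qcoord_qrealM c a x : qcoord c (qreal a * x) = a * qcoord c x.
Proof. by case: c => -[|[|[|[|]]]] //= ?; rewrite /qcoord /=; ring. Qed.

Lemma qrealC a x : x * qreal a = qreal a * x.
Proof. by apply: quat_eq => /=; ring. Qed.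

Lemma qrealM a a' : qreal (a * a') = qreal a * qreal a' :> quat R.
Proof. by apply: quat_eq => /=; ring. Qed.

Lemma qrealX a n : qreal a ^+ n = qreal (a ^+ n) :> quat R.
Proof. by elim: n => [|n IH]; rewrite ?expr0 // !exprS IH -qrealM. Qed.

Lemma quat_coordP x y : (forall c, qcoord c x = qcoord c y) -> x = y.
Proof.
move=> h; apply: quat_eq.
- exact: (h (@Ordinal 4 0 isT)).
- exact: (h (@Ordinal 4 1 isT)).
- exact: (h (@Ordinal 4 2 isT)).
- exact: (h (@Ordinal 4 3 isT)).
Qed.

Lemma qconjM x y : qconj (x * y) = qconj y * qconj x.
Proof. by apply: quat_eq => /=; ring. Qed.

Lemma qconjX x n : qconj (x ^+ n) = qconj x ^+ n.
Proof.
elim: n => [|n IH]; first by rewrite !expr0; apply: quat_eq; rewrite /= ?oppr0.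
by rewrite exprS qconjM IH -exprSr.
Qed.

Lemma qconjK x : qconj (qconj x) = x.
Proof. by apply: quat_eq => /=; rewrite ?opprK. Qed.

Lemma qconjD x y : qconj (x + y) = qconj x + qconj y.
Proof. by apply: quat_eq => /=; rewrite ?opprD. Qed.

Lemma qconj_sum (I : Type) (r : seq I) (F : I -> quat R) :
  qconj (\sum_(i <- r) F i) = \sum_(i <- r) qconj (F i).
Proof.
apply: (big_morph (@qconj R) qconjD).
by apply: quat_eq; rewrite /= ?oppr0.
Qed.

Lemma adjmxK (m n : nat) (A : 'M[quat R]_(m, n)) : A^h^h = A.
Proof. by apply/matrixP => i j; rewrite !mxE qconjK. Qed.

Lemma qnormE x : `|x| = Num.sqrt (qre x ^+ 2 + qi x ^+ 2 + qj x ^+ 2 + qk x ^+ 2).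
Proof. by []. Qed.

Lemma qnormM x y : `|x * y| = `|x| * `|y|.
Proof.
by rewrite !qnormE -sqrtrM ?qsqr_ge0 //; congr Num.sqrt; rewrite /=; ring.
Qed.

Lemma qnorm1 : `|1 : quat R| = 1.
Proof. by rewrite qnormE /= expr1n expr0n /= !addr0 sqrtr1. Qed.

Lemma qnormX x n : `|x ^+ n| = `|x| ^+ n.
Proof. by elim: n => [|n IH]; rewrite ?expr0 ?qnorm1 // !exprS qnormM IH. Qed.

Lemma qnorm_conj x : `|qconj x| = `|x|.
Proof. by rewrite !qnormE /= !sqrrN. Qed.

Lemma qnorm_real a : 0 <= a -> `|qreal a : quat R| = a.
Proof. by move=> a0; rewrite qnormE /= expr0n /= !addr0 sqrtr_sqr ger0_norm. Qed.

Lemma qcoord_le c x : `|qcoord c x| <= `|x|.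
Proof.
rewrite qnormE -sqrtr_sqr ler_sqrt ?qsqr_ge0 //.
have := sqr_ge0 (qre x); have := sqr_ge0 (qi x); have := sqr_ge0 (qj x).
have := sqr_ge0 (qk x).
by case: c => -[|[|[|[|]]]] //= ?; rewrite /qcoord /=; lra.
Qed.

Lemma qnorm_le x : `|x| <= \sum_c `|qcoord c x|.
Proof.
have -> : x = \sum_c qcoord c x *: nth 0 [:: 1; Quat 0 1 0 0; Quat 0 0 1 0; Quat 0 0 0 1] c.
  by rewrite !big_ord_recl big_ord0; apply: quat_eq; rewrite /qcoord /= ; ring.
apply: le_trans (ler_norm_sum _ _ _) _; apply: ler_sum => c _.
rewrite normrZ -[X in _ <= X]mulr1.
have h y d : qcoord d (\sum_c qcoord c y *:
    nth 0 [:: 1; Quat 0 1 0 0; Quat 0 0 1 0; Quat 0 0 0 1] c) = qcoord d y.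
  congr qcoord; rewrite !big_ord_recl big_ord0.
  by apply: quat_eq; rewrite /qcoord /= ; ring.
rewrite h ler_wpM2l //.
by case: c => -[|[|[|[|]]]] //= ?; rewrite qnormE /= ?expr1n ?expr0n /= ?add0r ?addr0 sqrtr1.
Qed.

End QuaternionCoordinates.

Lemma cvg_sum_seq (K : numFieldType) (V : normedModType K) (I : Type) (r : seq I)
    (u : I -> nat -> V) (l : I -> V) : (forall i, u i n @[n --> \oo] --> l i) ->
  (\sum_(i <- r) u i n) @[n --> \oo] --> \sum_(i <- r) l i.
Proof.
move=> h; elim: r => [|i r IH].
  by rewrite big_nil (_ : (fun n => _) = fun=> 0); [exact: cvg_cst|apply/funext => n; rewrite big_nil].
rewrite big_cons (_ : (fun n => _) = fun n => u i n + \sum_(i <- r) u i n).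
  exact: cvgD (h i) IH.
by apply/funext => n; rewrite big_cons.
Qed.

(** * Convergence of quaternionic matrices, coordinate by coordinate *)

Section QuaternionConvergence.
Variable R : realType.

Lemma cvg_quatP (f : nat -> quat R) l :
  f @ \oo --> l <-> forall c, qcoord c (f n) @[n --> \oo] --> qcoord c l.
Proof.
split=> [fl c|fl].
  apply/cvgrPdist_lt => e e0; have /cvgrPdist_lt/(_ _ e0) := fl.
  apply: filterS => n; apply: le_lt_trans.
  by rewrite -qcoordN -qcoordD; exact: qcoord_le.
apply/cvgrPdist_lt => e e0.
have : \sum_c `|qcoord c l - qcoord c (f n)| @[n --> \oo] --> (0 : R).
  have {2}-> : 0 = \sum_(c < 4) 0 :> R by rewrite big1.
  apply: (@cvg_sum_seq _ R^o _ _ (fun c n => `|qcoord c l - qcoord c (f n)|) (fun=> 0)) => c.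
  have := cvg_norm (cvgB (cvg_cst (qcoord c l)) (fl c)).
  by rewrite subrr normr0; apply.
move=> /cvgrPdist_lt/(_ _ e0); apply: filterS => n; rewrite sub0r normrN.
rewrite ger0_norm ?sumr_ge0 //; apply: le_lt_trans.
apply: le_trans (qnorm_le _) _; apply: ler_sum => c _.
by rewrite qcoordD qcoordN.
Qed.

Lemma cvg_mxP (T : topologicalType) (m n : nat) (f : nat -> 'M[T]_(m, n)) (A : 'M[T]_(m, n)) :
  f @ \oo --> A <-> forall i j, f k i j @[k --> \oo] --> A i j.
Proof.
split=> [fA i j U nU|fA].
  apply: (fA [set B | U (B i j)]).
  exists (fun i' j' => [set x | (i', j') = (i, j) -> U x]).
    move=> i' j'; have [[-> ->]|ne] := eqVneq (i', j') (i, j).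
      by apply: filterS nU => x Ux _.
    by apply: filterS (@filterT _ (nbhs (A i' j')) _) => x _ /= eq; rewrite eq eqxx in ne.
  by move=> B; apply.
move=> U [P nP PU]; apply: (@filterS _ _ _ [set k | forall i j, P i j (f k i j)]).
  by move=> k; exact: PU.
have h : \forall k \near \oo, forall ij : 'I_m * 'I_n, P ij.1 ij.2 (f k ij.1 ij.2).
  by apply: filter_forall => -[i j]; exact: fA (nP i j).
by apply: filterS h => k h i j; exact: (h (i, j)).
Qed.

Lemma cvg_qmxP (m n : nat) (f : nat -> 'M[quat R]_(m, n))
    (A : 'M[quat R]_(m, n)) :
  f @ \oo --> A <->
  forall i j c, qcoord c (f k i j) @[k --> \oo] --> qcoord c (A i j).
Proof.
split=> [/cvg_mxP fA i j|fA]; first exact/cvg_quatP.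
by apply/cvg_mxP => i j; apply/cvg_quatP => c.
Qed.

Lemma lim_qmx (m n : nat) (f : nat -> 'M[quat R]_(m, n))
    (A : 'M[quat R]_(m, n)) :
  f @ \oo --> A -> lim (f @ \oo) = A.
Proof.
move=> fA; have /cvg_qmxP fl := cvgP _ fA; have /cvg_qmxP fA' := fA.
apply/matrixP => i j; apply: quat_coordP => c.
exact: (cvg_unique _ (fl i j c) (fA' i j c)).
Qed.

Lemma series_qmxE (m n : nat) (u : nat -> 'M[quat R]_(m, n)) k i j c :
  qcoord c (series u k i j) = series (fun l => qcoord c (u l i j)) k.
Proof. by rewrite !seriesEord /= summxE qcoord_sum. Qed.

Lemma cvg_qmulmx (m n p q : nat) (X : 'M[quat R]_(m, n)) (Y : 'M[quat R]_(p, q))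
    (f : nat -> 'M[quat R]_(n, p)) (A : 'M[quat R]_(n, p)) :
  f @ \oo --> A -> (X *m f k *m Y) @[k --> \oo] --> X *m A *m Y.
Proof.
move=> /cvg_mxP fA; apply/cvg_mxP => i j; rewrite mxE.
rewrite (_ : (fun k => _) = fun k => \sum_l (X *m f k) i l * Y l j); last first.
  by apply/funext => k; rewrite mxE.
apply: cvg_sum_seq => l; rewrite mxE mulr_suml.
rewrite (_ : (fun k => _) = fun k => \sum_h X i h * f k h l * Y l j); last first.
  by apply/funext => k; rewrite mxE mulr_suml.
apply: (@cvg_sum_seq _ _ _ _ (fun h k => X i h * f k h l * Y l j)) => h.
apply/cvgrPdist_lt => e e0.
(* The summand 1 keeps the denominator positive when X i h or Y l j vanishes. *)
have d0 : 0 < e / (`|X i h| * `|Y l j| + 1).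
  by rewrite divr_gt0 // ltr_wpDl ?mulr_ge0.
have /cvgrPdist_lt/(_ _ d0) := fA h l; apply: filterS => k.
rewrite ltr_pdivlMr ?ltr_wpDl ?mulr_ge0 // => lt; apply: le_lt_trans lt.
rewrite -mulrBl -mulrBr !qnormM mulrAC mulrC ler_wpM2l //.
by rewrite lerDl.
Qed.

End QuaternionConvergence.

(** * Quaternionic matrices as real matrices *)

Section Realification.
Variable R : realType.

Definition coordT (m n : nat) (f : quat R -> R) (A : 'M[quat R]_(m, n)) :
  'M[R]_(n, m) := \matrix_(j, i) f (A i j).

Definition rvec (n : nat) (x : 'cV[quat R]_n) : 'rV[R]_((n + n) + (n + n)) :=
  row_mx (row_mx (coordT (@qre R) x) (coordT (@qi R) x))
         (row_mx (coordT (@qj R) x) (coordT (@qk R) x)).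

(* The matrix of x |-> A *m x in the real coordinates rvec, acting on row
   vectors from the right. *)
Definition realmx (m n : nat) (A : 'M[quat R]_(m, n)) :
    'M[R]_((n + n) + (n + n), (m + m) + (m + m)) :=
  let a := coordT (@qre R) A in let b := coordT (@qi R) A in
  let c := coordT (@qj R) A in let d := coordT (@qk R) A in
  block_mx (block_mx a b (- b) a) (block_mx c d d (- c))
           (block_mx (- c) (- d) (- d) c) (block_mx a b (- b) a).

Definition unrvec (n : nat) (v : 'rV[R]_((n + n) + (n + n))) : 'cV[quat R]_n :=
  \col_i Quat (v 0 (lshift (n + n) (lshift n i))) (v 0 (lshift (n + n) (rshift n i)))
              (v 0 (rshift (n + n) (lshift n i))) (v 0 (rshift (n + n) (rshift n i))).

Lemma unrvecK n (v : 'rV[R]_((n + n) + (n + n))) : rvec (unrvec v) = v.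
Proof.
rewrite /rvec -[RHS]hsubmxK -[lsubmx v]hsubmxK -[rsubmx v]hsubmxK.
by congr (row_mx (row_mx _ _) (row_mx _ _)); apply/rowP => i; rewrite !mxE.
Qed.

Lemma rvecM m n (A : 'M[quat R]_(m, n)) (x : 'cV[quat R]_n) :
  rvec (A *m x) = rvec x *m realmx A.
Proof.
rewrite /rvec /realmx /= mul_row_block !mul_row_block !add_row_mx.
congr (row_mx (row_mx _ _) (row_mx _ _)); apply/rowP => i; rewrite !mxE.
- rewrite qre_sum -!big_split; apply: eq_bigr => j _; rewrite !mxE /=; ring.
- rewrite qi_sum -!big_split; apply: eq_bigr => j _; rewrite !mxE /=; ring.
- rewrite qj_sum -!big_split; apply: eq_bigr => j _; rewrite !mxE /=; ring.
- rewrite qk_sum -!big_split; apply: eq_bigr => j _; rewrite !mxE /=; ring.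
Qed.

(** By this, the product S(x) S(y)^* becomes a product of a real matrix and a transpose, the shape
    required by [hE]. *)
Lemma realmx_adj m n (A : 'M[quat R]_(m, n)) : realmx A^h = (realmx A)^T.
Proof.
rewrite /realmx /= !tr_block_mx !linearN /=.
have -> : coordT (@qre R) A^h = (coordT (@qre R) A)^T.
  by apply/matrixP => i j; rewrite !mxE.
have -> : coordT (@qi R) A^h = - (coordT (@qi R) A)^T.
  by apply/matrixP => i j; rewrite !mxE.
have -> : coordT (@qj R) A^h = - (coordT (@qj R) A)^T.
  by apply/matrixP => i j; rewrite !mxE.
have -> : coordT (@qk R) A^h = - (coordT (@qk R) A)^T.
  by apply/matrixP => i j; rewrite !mxE.
by rewrite !opprK.
Qed.

Lemma rvecB n (x y : 'cV[quat R]_n) : rvec (x - y) = rvec x - rvec y.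
Proof.
rewrite /rvec !opp_row_mx !add_row_mx.
by congr (row_mx (row_mx _ _) (row_mx _ _)); apply/rowP => i; rewrite !mxE.
Qed.

Lemma rvecD n (x y : 'cV[quat R]_n) : rvec (x + y) = rvec x + rvec y.
Proof.
rewrite /rvec !add_row_mx.
by congr (row_mx (row_mx _ _) (row_mx _ _)); apply/rowP => i; rewrite !mxE.
Qed.

Lemma rvec0 n : rvec (0 : 'cV[quat R]_n) = 0.
Proof. by apply: (addrI (rvec 0)); rewrite -rvecD !addr0. Qed.

Lemma rvec_sum n (I : Type) (r : seq I) (P : pred I) (F : I -> 'cV[quat R]_n) :
  rvec (\sum_(i <- r | P i) F i) = \sum_(i <- r | P i) rvec (F i).
Proof. exact: (big_morph (@rvec n) (@rvecD n) (rvec0 n)). Qed.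

Lemma rvec_qreal n a (x : 'cV[quat R]_n) : rvec (qreal a *: x) = a *: rvec x.
Proof.
rewrite /rvec !scale_row_mx.
by congr (row_mx (row_mx _ _) (row_mx _ _)); apply/rowP => i; rewrite !mxE /=; ring.
Qed.

Lemma dotv_rvec n (x y : 'cV[quat R]_n) :
  dotv (rvec x) (rvec y) = qre ((x^h *m y) 0 0).
Proof.
rewrite /dotv /rvec !tr_row_mx !mul_row_col !mxE qre_sum -!big_split.
by apply: eq_bigr => i _; rewrite !mxE /=; ring.
Qed.

(** The sign and the indices do not depend on A, so power series expansions pass from the
    coordinates of S to the entries of its realification. *)
Lemma realmx_entry m n i j : exists (e : R) (r : 'I_m) (s : 'I_n) (c : 'I_4),
  forall A : 'M[quat R]_(m, n), realmx A i j = e * qcoord c (A r s).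
Proof.
case: (split_ordP i) => i1 ->; case: (split_ordP i1) => i2 ->;
case: (split_ordP j) => j1 ->; case: (split_ordP j1) => j2 ->;
rewrite /realmx /=;
by [ exists 1, j2, i2, (@Ordinal 4 0 isT) => A;
     rewrite ?(block_mxEul, block_mxEur, block_mxEdl, block_mxEdr) !mxE mul1r
   | exists 1, j2, i2, (@Ordinal 4 1 isT) => A;
     rewrite ?(block_mxEul, block_mxEur, block_mxEdl, block_mxEdr) !mxE mul1r
   | exists 1, j2, i2, (@Ordinal 4 2 isT) => A;
     rewrite ?(block_mxEul, block_mxEur, block_mxEdl, block_mxEdr) !mxE mul1r
   | exists 1, j2, i2, (@Ordinal 4 3 isT) => A;
     rewrite ?(block_mxEul, block_mxEur, block_mxEdl, block_mxEdr) !mxE mul1r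
   | exists (- 1), j2, i2, (@Ordinal 4 1 isT) => A;
     rewrite ?(block_mxEul, block_mxEur, block_mxEdl, block_mxEdr) !mxE mulN1r
   | exists (- 1), j2, i2, (@Ordinal 4 2 isT) => A;
     rewrite ?(block_mxEul, block_mxEur, block_mxEdl, block_mxEdr) !mxE mulN1r
   | exists (- 1), j2, i2, (@Ordinal 4 3 isT) => A;
     rewrite ?(block_mxEul, block_mxEur, block_mxEdl, block_mxEdr) !mxE mulN1r].
Qed.

Lemma qcoord_conj (c : 'I_4) : exists e : R, forall x, qcoord c (qconj x) = e * qcoord c x.
Proof.
case: c => -[|[|[|[|]]]] //= ?; [exists 1 | exists (-1) ..] => x;
  by rewrite /qcoord /= ?mul1r ?mulN1r.
Qed.

End Realification.

(** * The Schur kernel and its values at real points *)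

Section SchurKernel.
Variable R : realType.

Lemma quat_of_coord (g : 'I_4 -> R) : exists x : quat R, forall c, qcoord c x = g c.
Proof.
exists (Quat (g (@Ordinal 4 0 isT)) (g (@Ordinal 4 1 isT))
             (g (@Ordinal 4 2 isT)) (g (@Ordinal 4 3 isT))) => c.
by case: c => -[|[|[|[|]]]] //= h; rewrite /qcoord /=; congr g; exact: val_inj.
Qed.

Lemma rscaleE (m n : nat) (A : 'M[quat R]_(m, n)) a i j :
  rscale A a i j = A i j * a.
Proof.
rewrite mxE (bigD1 j) //= mxE eqxx mulr1n big1 ?addr0 // => k kj.
by rewrite mxE (negPf kj) mulr0n mulr0.
Qed.

(** Each real coordinate is dominated by a geometric series of ratio |p| |q|. *)
Lemma schur_series_cvg (m n : nat) (p q : quat R) (A : 'M[quat R]_(m, n)) :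
  `|p| < 1 -> `|q| < 1 -> exists L : 'M[quat R]_(m, n),
  series (fun n => rscale (p ^+ n *: A) (q ^+ n)) @ \oo --> L.
Proof.
move=> p1 q1.
have coord_cvg i j c : cvg (series (fun n => qcoord c (p ^+ n * A i j * q ^+ n)) @ \oo).
  apply: normed_cvg; apply: series_le_cvg (@is_cvg_geometric_series _ `|A i j| (`|p| * `|q|) _).
  - by move=> k; exact: normr_ge0.
  - by move=> k; rewrite /= mulr_ge0 ?exprn_ge0 // ?mulr_ge0.
  - move=> k; apply: le_trans (qcoord_le _ _) _; rewrite /=.
    rewrite !qnormM !qnormX mulrAC mulrC -exprMn; exact: lexx.
  by rewrite ger0_norm ?mulr_ge0 // mulr_ilt1.
have ex i j : {x : quat R | forall c,
    qcoord c x = lim (series (fun n => qcoord c (p ^+ n * A i j * q ^+ n)) @ \oo)}.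
  exact: cid (quat_of_coord _).
exists (\matrix_(i, j) sval (ex i j)); apply/cvg_qmxP => i j c.
rewrite mxE (svalP (ex i j)).
rewrite (_ : (fun k => _) = series (fun n => qcoord c (p ^+ n * A i j * q ^+ n))).
  exact: coord_cvg.
apply/funext => k; rewrite series_qmxE; congr (series _ k); apply/funext => l.
by rewrite rscaleE mxE.
Qed.

Lemma schur_kernel_cvg (N M : nat) (S : qball R -> 'M[quat R]_(N, M)) (p q : qball R) :
  series (fun n => rscale ((val p) ^+ n *: (1%:M - S p *m (S q)^h))
                          (qconj (val q) ^+ n)) @ \oo --> schur_kernel S p q.
Proof.
have [] := @schur_series_cvg _ _ (val p) (qconj (val q)) (1%:M - S p *m (S q)^h).
- exact: (valP p).
- by rewrite qnorm_conj; exact: (valP q).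
by move=> L hL; rewrite /schur_kernel (lim_qmx hL).
Qed.

Let qball0 : qball R.
Proof. by exists 0; rewrite normr0. Defined.

(* The real points of the ball; the origin when the argument is not in (-1, 1). *)
Definition rball (x : R) : qball R :=
  if pselect (`|qreal x : quat R| < 1) is left h
  then exist (fun p : quat R => `|p| < 1) (qreal x) h else qball0.

Lemma val_rball x : 0 < x -> x < 1 -> val (rball x) = qreal x.
Proof.
move=> x0 x1; rewrite /rball; case: pselect => //.
by rewrite qnorm_real ?ltW.
Qed.

(** Real scalars are central, so the two-sided series collapses to a geometric one of ratio x y. *)
Lemma schur_kernel_real (N M : nat) (S : qball R -> 'M[quat R]_(N, M)) x y :
  0 < x -> x < 1 -> 0 < y -> y < 1 ->
  qreal (1 - x * y) *: schur_kernel S (rball x) (rball y) =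
  1%:M - S (rball x) *m (S (rball y))^h.
Proof.
move=> x0 x1 y0 y1; have := @schur_kernel_cvg _ _ S (rball x) (rball y).
set A := 1%:M - _ => /cvg_qmxP hK.
apply/matrixP => i j; apply: quat_coordP => c; rewrite mxE qcoord_qrealM.
have : series (geometric (qcoord c (A i j)) (x * y)) @ \oo -->
    qcoord c (A i j) * (1 - x * y)^-1.
  by apply: cvg_geometric_series; rewrite gtr0_norm ?mulr_gt0 //; nra.
move: (hK i j c).
rewrite (_ : (fun k => _) = series (geometric (qcoord c (A i j)) (x * y))); last first.
  apply/funext => k; rewrite series_qmxE; congr (series _ k); apply/funext => l.
  rewrite rscaleE mxE !val_rball // (_ : qconj (qreal y) = qreal y); last first.
    by apply: quat_eq; rewrite /= ?oppr0.
  rewrite !qrealX qrealC qcoord_qrealM qcoord_qrealM /= exprMn; ring.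
move=> h1 h2; rewrite (cvg_unique _ h1 h2) // mulrC divfK //.
by rewrite lt0r_neq0 // subr_gt0; nra.
Qed.

Definition col_sqr (n : nat) (x : 'cV[quat R]_n) : R := qre ((x^h *m x) 0 0).

Lemma col_sqrE n (x : 'cV[quat R]_n) : col_sqr x = dotv (rvec x) (rvec x).
Proof. by rewrite dotv_rvec. Qed.

Lemma col_sqr_ge0 n (x : 'cV[quat R]_n) : 0 <= col_sqr x.
Proof. by rewrite col_sqrE dotv_ge0. Qed.

Lemma power_series_real (N M : nat) (S : qball R -> 'M[quat R]_(N, M))
    (s : nat -> 'M[quat R]_(N, M)) (hs : has_power_series S s) x i j c :
  0 < x -> x < 1 ->
  psum (fun n => qcoord c (s n i j)) x (qcoord c (S (rball x) i j)).
Proof.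
move=> x0 x1; have /cvg_qmxP /(_ i j c) := hs (rball x).
rewrite (_ : (fun k => _) = series (fun n => qcoord c (s n i j) * x ^+ n)) //.
apply/funext => k; rewrite series_qmxE; congr (series _ k); apply/funext => n.
by rewrite mxE val_rball // qrealX qcoord_qrealM mulrC.
Qed.

Lemma finite_dim_toeplitz_contraction (N M t : nat)
    (S : qball R -> 'M[quat R]_(N, M)) (s : nat -> 'M[quat R]_(N, M))
    (e : qball R -> 'M[quat R]_(N, t)) :
  has_power_series S s ->
  (forall q c, exists a : 'cV_t, forall p, schur_kernel S p q *m c = e p *m a) ->
  forall (U : nat -> 'cV[quat R]_N) (K L : nat),
  \sum_(k < K) col_sqr (\sum_(n < L | (k <= n)%N) (s (n - k)%N)^h *m U n) <=
  \sum_(n < L) col_sqr (U n).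
Proof.
move=> hs he U K L.
(* Rows act from the left, so the symbol is the realification of S(x)^*: c *m F y stands for S(y)^*
   c. *)
pose F x := realmx (S (rball x))^h; pose sg n := realmx (s n)^h.
pose E x := realmx (e (rball x)).
pose alpha y v := rvec (sval (cid (he (rball y) (unrvec v)))).
have hF x : 0 < x -> x < 1 -> forall i j, psum (fun n => sg n i j) x (F x i j).
  move=> x0 x1 i j; have [d [r [l [c h]]]] := realmx_entry R i j.
  have [d' h'] := qcoord_conj R c.
  rewrite /F h !mxE h' (_ : (fun n => _) = fun n => d * (d' * qcoord c (s n l r))).
    by apply: psumZ; apply: psumZ; exact: power_series_real.
  by apply/funext => n; rewrite /sg h !mxE h'.
have hE x y c : 0 < x -> x < 1 -> 0 < y -> y < 1 ->
    c - c *m F y *m (F x)^T = (1 - x * y) *: (alpha y c *m E x).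
  move=> x0 x1 y0 y1; rewrite /alpha /E /F -rvecM -realmx_adj.
  case: cid => a /= ha; rewrite -ha -{1 2}(unrvecK c) -!rvecM -rvecB -rvec_qreal.
  by rewrite adjmxK scalemxAl schur_kernel_real // mulmxBl mul1mx mulmxA.
have := toeplitz_contraction_seq hF hE (fun n => rvec (U n)) K L.
set LHS := (X in X <= _ -> _); set RHS := (X in _ <= X -> _).
have -> : RHS = \sum_(n < L) col_sqr (U n).
  by apply: eq_bigr => n _; rewrite col_sqrE.
have -> // : LHS = \sum_(k < K) col_sqr (\sum_(n < L | (k <= n)%N) (s (n - k)%N)^h *m U n).
apply: eq_bigr => k _; rewrite col_sqrE rvec_sum.
by congr dotv; apply: eq_bigr => n _; rewrite rvecM.
Qed.

End SchurKernel.

(** * Positivity of the kernel on the whole ball, and the factorization *)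

Section KernelPositivity.
Variable R : realType.

Lemma adjmxM (m n p : nat) (A : 'M[quat R]_(m, n)) (B : 'M[quat R]_(n, p)) :
  (A *m B)^h = B^h *m A^h.
Proof.
apply/matrixP => i j; rewrite !mxE qconj_sum; apply: eq_bigr => k _.
by rewrite qconjM !mxE.
Qed.

Lemma adjmx_sum (m n : nat) (I : Type) (r : seq I) (F : I -> 'M[quat R]_(m, n)) :
  (\sum_(i <- r) F i)^h = \sum_(i <- r) (F i)^h.
Proof.
apply/matrixP => i j; rewrite !mxE !summxE qconj_sum; apply: eq_bigr => k _.
by rewrite !mxE.
Qed.

Lemma adjmx_scalar (n : nat) (a : quat R) : (a%:M : 'M[quat R]_n)^h = (qconj a)%:M.
Proof.
apply/matrixP => i j; rewrite !mxE eq_sym; case: eqP => _; rewrite ?mulr1n // !mulr0n.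
by apply: quat_eq; rewrite /= ?oppr0.
Qed.

Lemma adjmxZ (m n : nat) a (A : 'M[quat R]_(m, n)) :
  (a *: A)^h = rscale A^h (qconj a).
Proof. by rewrite -mul_scalar_mx adjmxM adjmx_scalar. Qed.

Lemma col_sqr_eq0 (n : nat) (x : 'cV[quat R]_n) : col_sqr x <= 0 -> x = 0.
Proof.
move=> x0; have /dotv_eq0 rx : dotv (rvec x) (rvec x) = 0.
  by apply/eqP; rewrite eq_le -col_sqrE x0 col_sqr_ge0.
have : rvec x = rvec 0 by rewrite rx rvec0.
move=> /eq_row_mx[/eq_row_mx[h0 h1] /eq_row_mx[h2 h3]].
by apply/colP => i; apply: quat_eq;
  [move/rowP/(_ i): h0|move/rowP/(_ i): h1|move/rowP/(_ i): h2|move/rowP/(_ i): h3];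
  rewrite !mxE.
Qed.

Lemma num_negative_eigenvalues_eq0 (m : nat) (A : 'M[quat R]_m) :
  (forall v : 'cV_m, 0 <= qre ((v^h *m A *m v) 0 0)) ->
  num_negative_eigenvalues A = 0%N.
Proof.
move=> A0; apply/eqP; rewrite -leqn0; apply/bigmax_leqP => k /asboolP[U [lam [_ eig neg]]].
rewrite leqNgt; apply/negP => k0; pose i := Ordinal k0.
have [Ui0 AUi] := eig i; have := A0 (col i U).
rewrite -mulmxA AUi mulmxA -/(rscale _ _) rscaleE qrealC.
have -> : qre (qreal (lam i) * ((col i U)^h *m col i U) 0 0) = lam i * col_sqr (col i U).
  by rewrite /= !mul0r !subr0.
rewrite nmulr_rge0 // => /col_sqr_eq0 h.
by rewrite h eqxx in Ui0.
Qed.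

Lemma col_sqr_cvg (n : nat) (x : nat -> 'cV[quat R]_n) (l : 'cV[quat R]_n) :
  (forall i c, qcoord c (x k i 0) @[k --> \oo] --> qcoord c (l i 0)) ->
  col_sqr (x k) @[k --> \oo] --> col_sqr l.
Proof.
move=> h; have E (y : 'cV[quat R]_n) :
    col_sqr y = \sum_i \sum_c qcoord c (y i 0) * qcoord c (y i 0).
  rewrite /col_sqr mxE qre_sum; apply: eq_bigr => i _; rewrite !mxE !big_ord_recl big_ord0 /qcoord /=; ring.
rewrite E (_ : (fun k => _) = fun k => \sum_i \sum_c qcoord c (x k i 0) * qcoord c (x k i 0)).
  apply: (@cvg_sum_seq _ R^o _ _
    (fun i k => \sum_c qcoord c (x k i 0) * qcoord c (x k i 0))) => i.
  apply: (@cvg_sum_seq _ R^o _ _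
    (fun c k => qcoord c (x k i 0) * qcoord c (x k i 0))) => c.
  by apply: cvgM; exact: h.
by apply/funext => k; rewrite E.
Qed.

Section Gram.
Variables (N M m : nat) (p : 'I_m -> qball R) (d : 'I_m -> 'cV[quat R]_N).

(** The k-th coefficient of the kernel sum_n p^n conj(q)^n at q = p l in direction d l; in these
    terms the two-sided series become sums over k of ordinary quadratic forms. *)
Let w k l : 'cV[quat R]_N := qconj (val (p l)) ^+ k *: d l.

Let wE (A : 'M[quat R]_N) k l j :
  (d l)^h *m rscale (val (p l) ^+ k *: A) (qconj (val (p j)) ^+ k) *m d j =
  (w k l)^h *m A *m w k j.
Proof.
rewrite /w adjmxZ qconjX qconjK /rscale -!mul_scalar_mx.
by rewrite !mulmxA.
Qed.

Let quadratic_cvg (A L : 'I_m -> 'I_m -> 'M[quat R]_N) :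
  (forall l j, series (fun n => rscale (val (p l) ^+ n *: A l j)
     (qconj (val (p j)) ^+ n)) @ \oo --> L l j) ->
  (fun n => \sum_(k < n) \sum_l \sum_j qre (((w k l)^h *m A l j *m w k j) 0 0)) @ \oo -->
  \sum_l \sum_j qre (((d l)^h *m L l j *m d j) 0 0).
Proof.
move=> hL.
pose T l j n := series (fun n => rscale (val (p l) ^+ n *: A l j)
     (qconj (val (p j)) ^+ n)) n.
rewrite (_ : (fun n => _) = fun n =>
    \sum_l \sum_j qre (((d l)^h *m T l j n *m d j) 0 0)).
  apply: (@cvg_sum_seq _ R^o _ _
    (fun l n => \sum_j qre (((d l)^h *m T l j n *m d j) 0 0))) => l.
  apply: (@cvg_sum_seq _ R^o _ _
    (fun j n => qre (((d l)^h *m T l j n *m d j) 0 0))) => j.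
  have /cvg_qmxP := cvg_qmulmx (X := (d l)^h) (Y := d j) (hL l j).
  exact: (fun h => h 0 0 (@Ordinal 4 0 isT)).
apply/funext => n; rewrite exchange_big; apply: eq_bigr => l _.
rewrite exchange_big; apply: eq_bigr => j _.
rewrite /T seriesEord /= mulmx_sumr mulmx_suml summxE.
rewrite qre_sum; apply: eq_bigr => k _.
by rewrite wE.
Qed.

Variables (S : qball R -> 'M[quat R]_(N, M)) (s : nat -> 'M[quat R]_(N, M)).
Hypothesis hs : has_power_series S s.
Hypothesis toeplitz_le : forall (U : nat -> 'cV[quat R]_N) (K L : nat),
  \sum_(k < K) col_sqr (\sum_(n < L | (k <= n)%N) (s (n - k)%N)^h *m U n) <=
  \sum_(n < L) col_sqr (U n).

(** Y is T^* U, because T^* acts on the sequence conj(p)^k d through S(p)^*. *)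
Let U k := \sum_l w k l.
Let Y k := \sum_l (S (p l))^h *m w k l.

Let col_sqr_U k : col_sqr (U k) =
  \sum_l \sum_j qre (((w k l)^h *m 1%:M *m w k j) 0 0).
Proof.
rewrite /col_sqr /U adjmx_sum mulmx_suml summxE qre_sum; apply: eq_bigr => l _.
rewrite mulmx_sumr summxE qre_sum; apply: eq_bigr => j _.
by rewrite mulmx1.
Qed.

Let col_sqr_Y k : col_sqr (Y k) =
  \sum_l \sum_j qre (((w k l)^h *m (S (p l) *m (S (p j))^h) *m w k j) 0 0).
Proof.
rewrite /col_sqr /Y adjmx_sum mulmx_suml summxE qre_sum; apply: eq_bigr => l _.
rewrite mulmx_sumr summxE qre_sum; apply: eq_bigr => j _.
by rewrite adjmxM adjmxK !mulmxA.
Qed.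

Let Y_cvg k : col_sqr (\sum_(n < L | (k <= n)%N) (s (n - k)%N)^h *m U n)
  @[L --> \oo] --> col_sqr (Y k).
Proof.
(* Cut at L + k, entry k of T^* U has exactly L terms, and these form the adjoint of a partial sum
   of S at each p l. *)
apply: col_sqr_cvg => i c; rewrite -(cvg_shiftn k).
rewrite (_ : (fun L => _) = fun L => \sum_l qcoord c
   ((1%:M *m (series (fun n => val (p l) ^+ n *: s n) L)^h *m w k l) i 0)).
  rewrite /Y summxE qcoord_sum.
  apply: (@cvg_sum_seq _ R^o _ _ (fun l L => qcoord c
   ((1%:M *m (series (fun n => val (p l) ^+ n *: s n) L)^h *m w k l) i 0))) => l.
  rewrite -[(S (p l))^h]mul1mx.
  have hadj : (series (fun n => val (p l) ^+ n *: s n) L)^h @[L --> \oo] --> (S (p l))^h.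
    apply/cvg_qmxP => i' j' c'; have [e he] := qcoord_conj R c'.
    rewrite !mxE he (_ : (fun L => _) = fun L => e * qcoord c'
      (series (fun n => val (p l) ^+ n *: s n) L j' i')).
      by apply: cvgMl_tmp; have /cvg_qmxP := @hs (p l).
    by apply/funext => L; rewrite !mxE he.
  have /cvg_qmxP := cvg_qmulmx (X := 1%:M) (Y := w k l) hadj.
  exact.
apply/funext => L; rewrite -qcoord_sum -summxE; congr (qcoord c (fun_of_matrix _ i 0)).
rewrite [(L + k)%N]addnC big_split_ord /= [X in X + _]big_pred0 ?add0r; last first.
  by move=> n; rewrite leqNgt ltn_ord.
rewrite big_mkcond /=.
under eq_bigr => n _ do rewrite leq_addr addKn addnC mulmx_sumr.
rewrite exchange_big; apply: eq_bigr => l _.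
rewrite mul1mx seriesEord /= adjmx_sum mulmx_suml; apply: eq_bigr => n _.
rewrite adjmxZ qconjX /w exprD -scalerA /rscale -mulmxA mul_scalar_mx.
by [].
Qed.

Lemma gram_form_ge0 :
  0 <= \sum_l \sum_j qre (((d l)^h *m schur_kernel S (p l) (p j) *m d j) 0 0).
Proof.
have hG := quadratic_cvg (fun l j => schur_kernel_cvg (S := S) (p := p l) (q := p j)).
have ex l j : {L : 'M[quat R]_N | series (fun n => rscale (val (p l) ^+ n *: 1%:M)
     (qconj (val (p j)) ^+ n)) @ \oo --> L}.
  apply: cid; apply: schur_series_cvg; first exact: (valP (p l)).
  by rewrite qnorm_conj; exact: (valP (p j)).
have := quadratic_cvg (fun l j => svalP (ex l j)).
set A := \sum_l \sum_j _ => hA.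
have UA : (fun n => \sum_(k < n) col_sqr (U k)) @ \oo --> A.
  rewrite (_ : (fun n => _) = fun n => \sum_(k < n) \sum_l \sum_j
    qre (((w k l)^h *m 1%:M *m w k j) 0 0)) //.
  by apply/funext => n; apply: eq_bigr => k _; rewrite col_sqr_U.
(* U has infinite support, so the contraction is applied to its truncations: K is fixed while L
   tends to infinity. *)
have YA K : \sum_(k < K) col_sqr (Y k) <= A.
  have YK : \sum_(k < K) col_sqr (\sum_(n < L | (k <= n)%N) (s (n - k)%N)^h *m U n)
      @[L --> \oo] --> \sum_(k < K) col_sqr (Y k).
    apply: (@cvg_sum_seq _ R^o _ _ (fun (k : 'I_K) L =>
      col_sqr (\sum_(n < L | (k <= n)%N) (s (n - k)%N)^h *m U n))) => k.
    exact: Y_cvg.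
  by apply: (ler_cvg_to YK UA); apply: nearW => L; exact: toeplitz_le.
(* The form is the limit of the partial sums of |U k|^2 - |Y k|^2. These are at least the partial
   sums of |U k|^2 minus A, which tend to 0. *)
have hD : (fun n => \sum_(k < n) col_sqr (U k) - A) @ \oo --> (0 : R).
  by have := cvgB UA (cvg_cst A); rewrite subrr; apply.
apply: (ler_cvg_to hD hG); apply: nearW => n.
apply: (@le_trans _ _ (\sum_(k < n) col_sqr (U k) - \sum_(k < n) col_sqr (Y k))).
  by rewrite lerD2l lerN2.
rewrite -sumrB le_eqVlt; apply/orP; left; apply/eqP; apply: eq_bigr => k _.
rewrite col_sqr_U col_sqr_Y -sumrB; apply: eq_bigr => l _.
rewrite -sumrB; apply: eq_bigr => j _.
rewrite mulmxBr mulmxBl [in RHS]mxE [X in qre (_ + X)]mxE.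
by [].
Qed.

End Gram.

(** The value of the Gram matrix at v is the form of the hypothesis at the vectors c l v l. *)
Lemma gram_ge0 (N m : nat) (K : qball R -> qball R -> 'M[quat R]_N)
    (p : 'I_m -> qball R) (c : 'I_m -> 'cV[quat R]_N) :
  (forall d : 'I_m -> 'cV[quat R]_N,
    0 <= \sum_l \sum_j qre (((d l)^h *m K (p l) (p j) *m d j) 0 0)) ->
  forall v : 'cV_m, 0 <= qre ((v^h *m gram_mx K p c *m v) 0 0).
Proof.
move=> h v; apply: le_trans (h (fun l => rscale (c l) (v l 0))) _.
rewrite le_eqVlt; apply/orP; left; apply/eqP.
rewrite mxE qre_sum exchange_big; apply: eq_bigr => j _.
rewrite mxE mulr_suml qre_sum; apply: eq_bigr => l _.
congr qre; have -> : v^h 0 l = qconj (v l 0) by rewrite !mxE.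
have -> : gram_mx K p c l j = ((c l)^h *m K (p l) (p j) *m c j) 0 0 by rewrite [LHS]mxE.
set X := (c l)^h *m _ *m _.
have -> : (rscale (c l) (v l 0))^h *m K (p l) (p j) *m rscale (c j) (v j 0) =
    rscale (qconj (v l 0) *: X) (v j 0).
  by rewrite /rscale adjmxM adjmx_scalar -mul_scalar_mx !mulmxA.
by rewrite rscaleE mxE.
Qed.

(** The realization with d = 0: the matrices A, C, G, P are empty, and both sides of the kernel
    identity vanish as I - I I^* = 0. *)
Lemma blaschke_product1 (N : nat) :
  blaschke_product (fun _ : qball R => 1%:M : 'M[quat R]_N).
Proof.
exists 0%N, 0, 0, 0, 1%:M, 1%:M, 1%:M; split.
- move=> q; rewrite (_ : (fun k => _) = fun=> 1%:M); first exact: cvg_cst.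
  apply/funext => k; rewrite seriesEord /= big1 ?addr0 // => n _.
  by rewrite mulmx0 scaler0.
- by move=> v _; rewrite flatmx0.
- split; last by rewrite mulmx1.
  split; first by rewrite /hermitian_mx adjmx_scalar; apply/matrixP; case.
  by move=> v; rewrite flatmx0 eqxx.
- by rewrite !flatmx0.
move=> p q; rewrite [_ *m 1%:M]thinmx0 mul0mx.
rewrite -(lim_qmx (@schur_kernel_cvg _ _ _ (fun=> 1%:M) p q)).
apply: lim_qmx; rewrite (_ : series _ = fun=> 0); first exact: cvg_cst.
apply/funext => k; rewrite seriesEord /= big1 // => n _.
rewrite adjmx_scalar (_ : qconj 1 = 1); last first.
  by apply: quat_eq; rewrite /= ?oppr0.
by rewrite mulmx1 subrr scaler0 /rscale mul0mx.
Qed.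

Lemma star_product1 (N M : nat) (S : qball R -> 'M[quat R]_(N, M)) :
  slice_hyperholomorphic S -> star_product (fun=> 1%:M) S S.
Proof.
move=> [s hs]; exists (fun n => if n is 0%N then 1%:M else 0), s; split=> //.
  move=> p; apply: cvg_near_cst; exists 1%N => // -[|n] // _ /=.
  rewrite seriesEord /= big_ord_recl expr0 scale1r big1 ?addr0 // => i _.
  by rewrite scaler0.
rewrite (_ : (fun n => _) = s) //; apply/funext => n.
rewrite big_ord_recl mul1mx subn0 big1 ?addr0 // => i _.
by rewrite /= mul0mx.
Qed.

End KernelPositivity.

Theorem theorem9p2 (R : realType) (N M : nat)
  (S : qball R -> 'M[quat R]_(N, M))
  (hS : slice_hyperholomorphic S)
  (kappa : nat) (hK : has_negative_squares (schur_kernel S) kappa)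
  (PS : set (qball R -> 'cV[quat R]_N))
  (ip : (qball R -> 'cV[quat R]_N) -> (qball R -> 'cV[quat R]_N) -> quat R)
  (hPS : rk_pontryagin_space (schur_kernel S) PS ip)
  (hfin : right_finite_dim PS) :
  exists (B : qball R -> 'M[quat R]_N) (S0 : qball R -> 'M[quat R]_(N, M)),
    blaschke_product B /\ schur_multiplier S0 /\ star_product B S S0.
Proof.
have [s hs] := hS; have [_ kerV kerE] := hPS; have [t [e [_ span]]] := hfin.
(* Kernel sections belong to P(S), so they are combinations of the t spanning functions, stored as
   the columns of a matrix. *)
have he q c : exists a : 'cV_t, forall p,
    schur_kernel S p q *m c = (\matrix_(i, j) e j p i 0) *m a.
  have [a fa] := span _ (kerV q c); exists (\col_j a j) => p.
  have -> : schur_kernel S p q *m c = (\sum_(j < t) fscale (e j) (a j)) p by rewrite -fa.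
  rewrite fct_sumE; apply/colP => i; rewrite summxE mxE.
  by apply: eq_bigr => j _; rewrite rscaleE !mxE.
have num0 m p c : num_negative_eigenvalues (gram_mx (m := m) (schur_kernel S) p c) = 0%N.
  apply: num_negative_eigenvalues_eq0; apply: gram_ge0 => d.
  apply: (gram_form_ge0 _ _ hs).
  exact: (finite_dim_toeplitz_contraction
    (e := fun p => \matrix_(i, j) e j p i 0) hs he).
exists (fun=> 1%:M), S; split; first exact: blaschke_product1.
split; last exact: star_product1.
split=> //; have [herm _ _] := hK; split=> //.
  by move=> m p c; rewrite num0.
(* The value 0 is attained by the empty family of points. *)
exists 0%N; have p : 'I_0 -> qball R by case.
by exists p, (fun=> 0).
Qed.
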